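(* For every fixed integer $k$ with $3\leq k\leq 6$, as the real number $X\to\infty$, $$\sum_{p\leq X}T_{2k}^+(p)\leq X^{3k/4+3/2+o(1)}\qquad\text{and}\qquad \sum_{p\le X}S_{2k}^-(p)\leq X^{7k/4+3/2+o(1)},$$ where the sums are over primes $p\le X$.
   Context: For a prime $p$, let $\mathcal{X}_p^+$ (resp. $\mathcal{X}_p^-$) be the set of even (resp. odd) Dirichlet characters modulo $p$, and $\chi_0$ the principal character. For $\chi$ modulo $p$ put $\eta_\chi=1$ if $\chi$ is odd and $0$ if even, and $\vartheta_p(x,\chi)=\sum_{n\ge1}\chi(n)n^{\eta_\chi}e^{-\pi n^2x/p}$. Define $T_{2k}^+(p)=\sum_{\chi\in\mathcal{X}_p^+,\ \chi\neq\chi_0}|\vartheta_p(1,\chi)|^{2k}$ and $S_{2k}^-(p)=\sum_{\chi\in\mathcal{X}_p^-}|\vartheta_p(1,\chi)|^{2k}$. *)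

(* Defs.v *)
From HB Require Import structures.
From mathcomp Require Import all_boot all_order all_algebra.
From mathcomp Require Import all_classical all_reals all_analysis.
From mathcomp Require Import complex.

Set Implicit Arguments.
Unset Strict Implicit.
Unset Printing Implicit Defensive.

Import Order.TTheory GRing.Theory Num.Theory numFieldNormedType.Exports.
Import ComplexField.Normc.

Local Open Scope classical_set_scope.
Local Open Scope complex_scope.
Local Open Scope ring_scope.

(* A Dirichlet character modulo p is represented by the function it induces
   on residue classes, extended by 0 to the non-units.  The modulus is always
   used with p prime: otherwise 'F_p is not the ring of residues mod p. *)
Definition dirichlet_character (R : realType) (p : nat)
    (chi : {ffun 'F_p -> R[i]}) : Prop :=
  GRing.monoid_morphism chi /\
  (forall a : 'F_p, chi a != 0 <-> a \is a GRing.unit).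

Definition principal_character (R : realType) (p : nat) :
    {ffun 'F_p -> R[i]} :=
  [ffun a : 'F_p => (a \is a GRing.unit)%:R].

Definition even_characters (R : realType) (p : nat) :
    set {ffun 'F_p -> R[i]} :=
  [set chi | dirichlet_character chi /\ chi (- 1) = 1].
Arguments even_characters : clear implicits.

Definition odd_characters (R : realType) (p : nat) :
    set {ffun 'F_p -> R[i]} :=
  [set chi | dirichlet_character chi /\ chi (- 1) = - 1].
Arguments odd_characters : clear implicits.

Definition eta (R : realType) (p : nat) (chi : {ffun 'F_p -> R[i]}) : nat :=
  if chi (- 1) == - 1 then 1%N else 0%N.

(* R[i]^o carries the topology of the norm of the field R[i]. *)
Definition theta (R : realType) (p : nat) (x : R)
    (chi : {ffun 'F_p -> R[i]}) : R[i] :=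
  \big[+%R/0]_(1 <= n <oo)
    (chi n%:R * (n%:R ^+ eta chi * expR (- (pi * n%:R ^+ 2 * x / p%:R)))%:C
      : R[i]^o).

(* T_{2k}^+(p) and S_{2k}^-(p).  The sums range over finite sets, so that the
   finitely supported sums below are the usual ones; normc is the modulus,
   with values in R. *)
Definition T_plus (R : realType) (k p : nat) : R :=
  \sum_(chi \in even_characters R p `\ principal_character R p)
    normc (theta 1 chi) ^+ (2 * k).

Definition S_minus (R : realType) (k p : nat) : R :=
  \sum_(chi \in odd_characters R p) normc (theta 1 chi) ^+ (2 * k).

(* Main.v *)
(** Expanding theta^k produces k-fold products of incomplete character sums, and
    the multiplicative large sieve bounds them on average over all primes
    p <= X.  Abel summation removes the p-dependent weights: their differences
    are at most 4 m^eta / m whatever p is, so theta(chi) is dominated by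
    N^eta sum_(m <= N) |S_m(chi)| / m with S_m(chi) = sum_(n <= m) chi(n) and
    N = X^(1/2 + o(1)).  Now S_m(chi)^k = sum_(n <= m^k) d(n) chi(n), where
    d(n) <= tau(n)^k = n^o(1), and the large sieve gives
      sum_p sum_chi |S_m(chi)|^(2k) <= (X^2 + m^k) m^k X^o(1),
    which is at most X^(3k/4 + 3/2 + o(1)) because 2 <= k <= 6. *)

Require Import Defs.
From HB Require Import structures.
From mathcomp Require Import all_boot all_order all_algebra.
From mathcomp Require Import all_classical all_reals all_analysis.
From mathcomp Require Import complex.
From mathcomp Require Import zify ring lra finfield.

Set Implicit Arguments.
Unset Strict Implicit.
Unset Printing Implicit Defensive.

Import Order.TTheory GRing.Theory Num.Theory numFieldNormedType.Exports.
Import ComplexField.Normc.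

Local Open Scope ring_scope.

(** ** The additive large sieve *)

(** The weights exp(-pi n^2 / p) vary with the modulus, whereas the large sieve wants one
    coefficient sequence for all [p]; hence the care for bounds free of [p]. The cutoff is X^(1/2 +
    d) because the weights are negligible once n^2 exceeds a multiple of X ln X. As m^k <= N^k =
    X^(k/2 + o(1)), the two terms of the sieve bound have exponents 2 + k/2 and k: the first is at
    most 3k/4 + 3/2 exactly when k >= 2, the second exactly when k <= 6. Odd characters pay a
    further N^(2k) = X^(k + o(1)), whence 7k/4. The sieve is finite algebra: all fractions b / p lie
    on one grid of M-th roots of unity, differences replace derivatives in Gallagher's inequality,
    and the huge M cancels. Each o(1) is first a fixed loss in the exponent and becomes a function
    tending to 0 only at the end. *)

Lemma sum_expr_unity (F : idomainType) (M : nat) (x : F) :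
  x ^+ M = 1 -> x != 1 -> \sum_(i < M) x ^+ i = 0.
Proof.
move=> xM x1; apply: (mulfI (x := x - 1)); first by rewrite subr_eq0.
by rewrite mulr0 -subrX1 xM subrr.
Qed.

Lemma prim_root_norm1 (C : numClosedFieldType) (M : nat) (z : C) :
  M.-primitive_root z -> `|z| = 1.
Proof.
move=> zP; apply/eqP; rewrite -(pexpr_eq1 (n := M)) ?(prim_order_gt0 zP)//.
by rewrite -normrX prim_expr_order// normr1.
Qed.

Lemma parseval (C : numClosedFieldType) (M : nat) (z : C) (c : nat -> C) :
  M.-primitive_root z ->
  \sum_(y < M) `|\sum_(n < M) c n * z ^+ (y * n)| ^+ 2 =
  M%:R * \sum_(n < M) `|c n| ^+ 2.
Proof.
move=> zP; have z1 := prim_root_norm1 zP.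
have z0 : z != 0 by rewrite -normr_gt0 z1.
have orth (n m : 'I_M) :
    \sum_(y < M) z ^+ (y * n) * (z ^+ (y * m))^* = (n == m)%:R * M%:R.
  have cz y : (z ^+ y)^* = (z ^+ y)^-1.
    by rewrite invC_norm normrX z1 !expr1n invr1 mul1r.
  under eq_bigr => y _.
    rewrite cz mulnC exprM [(y * m)%N]mulnC [z ^+ (m * y)]exprM -exprVn -exprMn.
    over.
  have [->|nm] := eqVneq n m.
    rewrite mulfV ?expf_neq0// mul1r.
    by under eq_bigr do rewrite expr1n; rewrite sumr_const card_ord.
  rewrite mul0r; apply: sum_expr_unity.
    rewrite expr_div_n -!exprM ![(_ * M)%N]mulnC !exprM.
    by rewrite (prim_expr_order zP) !expr1n divr1.
  apply: contra nm => /eqP rE.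
  have : z ^+ n == z ^+ m by rewrite -[z ^+ n](divfK (expf_neq0 m z0)) rE mul1r.
  by rewrite (eq_prim_root_expr zP) !modn_small.
under eq_bigr => y _.
  rewrite normCK raddf_sum big_distrl /=; under eq_bigr do rewrite big_distrr /=.
  over.
rewrite exchange_big big_distrr /=; apply: eq_bigr => n _.
rewrite exchange_big /= (bigD1 n)//= [X in _ + X]big1 ?addr0 => [|m mn];
  under eq_bigr do rewrite rmorphM mulrACA; rewrite -big_distrr /= orth.
  by rewrite eqxx mul1r normCK mulrC.
by rewrite eq_sym (negbTE mn) mul0r mulr0.
Qed.

(** After exchanging the sums it remains to see that each [y] is hit at most once: two windows
    through the same [y] would start less than [H] apart. *)
Lemma sum_disjoint_windows (R : numDomainType) (G : nat -> R) (H M : nat)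
    (P : seq nat) :
  (forall y, 0 <= G y) -> uniq P -> {in P, forall x, x + H <= M}%N ->
  {in P &, forall x y, x < y -> x + H <= y}%N ->
  \sum_(x <- P) \sum_(j < H) G (x + j)%N <= \sum_(y < M) G y.
Proof.
move=> G0 Pu PM Psep.
have E x : x \in P -> \sum_(j < H) G (x + j)%N =
    \sum_(y < M) G y * (x <= y < x + H)%N%:R.
  move=> xP; have xM := PM _ xP.
  under [RHS]eq_bigr do rewrite mulr_natr mulrb.
  rewrite -big_mkcond /= -(big_mkord (fun y => (x <= y < x + H)%N)) /=.
  rewrite -(big_mkord xpredT (fun j => G (x + j)%N)).
  transitivity (\sum_(x <= y < x + H) G y).
    by rewrite -{2}[x]add0n big_addn addKn; apply: eq_bigr => j _; rewrite addnC.
  rewrite (big_nat_widen _ _ _ _ _ xM) (big_nat_widenl _ 0)//.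
  by apply: eq_bigl => y; rewrite /= andbC.
rewrite (eq_big_seq _ E) exchange_big /=; apply: ler_sum => y _.
rewrite -big_distrr /= ler_piMr//.
rewrite -natr_sum lern1.
have -> : (\sum_(x <- P) (x <= y < x + H) = count (fun x => x <= y < x + H) P)%N.
  by elim: (P) => [|x s IH]; rewrite ?big_nil// big_cons IH.
rewrite -size_filter; set s := seq.filter _ P.
have sP x : x \in s -> (x \in P) /\ (x <= y < x + H)%N.
  by rewrite mem_filter => /andP[].
have : uniq s by rewrite filter_uniq.
case: s sP => [|a [|b s]]// sP /=.
have [aP ay] := sP a (mem_head _ _).
have [bP by'] : (b \in P) /\ (b <= y < b + H)%N by apply: sP; rewrite !inE eqxx orbT.
rewrite inE negb_or => /andP[/andP[ab _] _]; exfalso.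
move: ab; rewrite neq_ltn => /orP[/Psep|/Psep] => [/(_ aP bP)|/(_ bP aP)]; lia.
Qed.

(** [g x] exceeds each of the [H] values in its window by at most the variation of [g] there; sum
    over the window, then over the disjoint windows. *)
Lemma discrete_gallagher (R : numDomainType) (g : nat -> R) (H M : nat)
    (P : seq nat) :
  (forall y, 0 <= g y) -> uniq P -> {in P, forall x, x + H <= M}%N ->
  {in P &, forall x y, x < y -> x + H <= y}%N ->
  H%:R * \sum_(x <- P) g x <=
  \sum_(y < M) g y + H%:R * \sum_(y < M) `|g y.+1 - g y|.
Proof.
move=> g0 Pu PM Psep.
have step x j : g x <= g (x + j)%N + \sum_(i < j) `|g (x + i).+1 - g (x + i)%N|.
  elim: j => [|j IH]; first by rewrite big_ord0 addr0 addn0.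
  apply: le_trans IH _; rewrite big_ord_recr/= addrA [leRHS]addrAC lerD2r.
  rewrite -lerBlDl addnS distrC; apply: real_ler_norm.
  by rewrite realB ?ger0_real.
have win x : H%:R * g x <= \sum_(j < H) g (x + j)%N +
    H%:R * \sum_(i < H) `|g (x + i).+1 - g (x + i)%N|.
  have HE t : H%:R * t = \sum_(j < H) t by rewrite sumr_const card_ord mulr_natl.
  rewrite !HE -big_split /=.
  apply: ler_sum => j _; apply: le_trans (step x j) _; rewrite lerD2l.
  rewrite (big_ord_widen _ (fun i => `|g (x + i).+1 - g (x + i)%N|) (ltnW (ltn_ord j))).
  by rewrite [leLHS]big_mkcond /=; apply: ler_sum => i _; case: ifP.
rewrite big_distrr /=; apply: (@le_trans _ _ (\sum_(x <- P) (\sum_(j < H) g (x + j)%N +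
    H%:R * \sum_(i < H) `|g (x + i).+1 - g (x + i)%N|))).
  by apply: ler_sum => x _.
rewrite big_split /= -big_distrr /=; apply: lerD; first exact: sum_disjoint_windows.
rewrite ler_wpM2l//.
exact: (sum_disjoint_windows (G := fun y => `|g y.+1 - g y|)).
Qed.

(** The norm of [R[i]] has values in [R[i]] itself; this is the passage to the real-valued
    [normc]. *)
Lemma normC_sqr (R : rcfType) (z : R[i]) : `|z| ^+ 2 = ((normc z) ^+ 2)%:C%C.
Proof. by rewrite rmorphXn. Qed.

Lemma normc_ge0 (R : rcfType) (z : R[i]) : 0 <= normc z.
Proof. by rewrite -(ler0c (R := R)) -[X in _ <= X]/(`|z|) normr_ge0. Qed.

Lemma normc_sum (R : rcfType) (I : Type) (r : seq I) (P : pred I) (F : I -> R[i]) :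
  normc (\sum_(i <- r | P i) F i) <= \sum_(i <- r | P i) normc (F i).
Proof.
elim/big_rec2: _ => [|i x y _ IH]; first by rewrite normc0.
by apply: le_trans (le_normcD _ _) _; rewrite lerD2l.
Qed.

Lemma normcX (R : rcfType) (z : R[i]) n : normc (z ^+ n) = normc z ^+ n.
Proof. by elim: n => [|n IH]; rewrite ?expr0 ?normc1// !exprS normcM IH. Qed.

Lemma normc_prim_root (R : rcfType) (M : nat) (z : R[i]) :
  M.-primitive_root z -> normc z = 1.
Proof. by move=> /prim_root_norm1 /complexI. Qed.

Lemma normc_exprB1_le (R : rcfType) (z : R[i]) n :
  normc z = 1 -> normc (z ^+ n - 1) <= n%:R * normc (z - 1).
Proof.
move=> z1; rewrite subrX1 normcM mulrC ler_wpM2r ?normc_ge0//.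
apply: le_trans (normc_sum _ _ _) _.
by under eq_bigr do rewrite normcX z1 expr1n; rewrite sumr_const card_ord.
Qed.

Lemma parseval_normc (R : rcfType) (M N : nat) (z : R[i]) (a : nat -> R[i]) :
  M.-primitive_root z -> (N <= M)%N ->
  \sum_(y < M) normc (\sum_(n < N) a n * z ^+ (y * n)) ^+ 2 =
  M%:R * \sum_(n < N) normc (a n) ^+ 2.
Proof.
move=> zP NM; apply: complexI.
have := parseval (fun n => if (n < N)%N then a n else 0) zP.
rewrite rmorphM rmorph_nat !rmorph_sum /= => E.
transitivity (\sum_(y < M) `|\sum_(n < M)
   (if (n < N)%N then a n else 0) * z ^+ (y * n)| ^+ 2).
  apply: eq_bigr => y _; rewrite -normC_sqr; congr (`|_| ^+ 2).
  rewrite (big_ord_widen _ (fun n => a n * z ^+ (y * n)) NM) big_mkcond /=.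
  by apply: eq_bigr => n _; case: ifP; rewrite ?mul0r.
rewrite E; congr (_ * _).
rewrite (big_ord_widen _ (fun n => (normc (a n) ^+ 2)%:C%C) NM) [RHS]big_mkcond /=.
by apply: eq_bigr => n _; case: ifP => _; [rewrite normC_sqr|rewrite normr0 expr0n].
Qed.

(** The left side is at most [d * (x + y)]; then AM-GM on [d * x] and [d * y] with a free weight
    [L]. *)
Lemma dist_sqr_le (R : realFieldType) (x y d L : R) : 0 < L -> 0 <= x -> 0 <= y ->
  `|x - y| <= d -> `|x ^+ 2 - y ^+ 2| <= L * d ^+ 2 + (x ^+ 2 + y ^+ 2) / (2 * L).
Proof.
move=> L0 x0 y0 xyd; rewrite subr_sqr normrM (ger0_norm (addr_ge0 x0 y0)).
apply: (@le_trans _ _ (d * (x + y))); first by rewrite ler_wpM2r ?addr_ge0.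
rewrite -lerBlDl ler_pdivlMr ?mulr_gt0//.
by have := sqr_ge0 (x - L * d); have := sqr_ge0 (y - L * d); nra.
Qed.

Lemma normc_dist (R : rcfType) (x y : R[i]) : `|normc x - normc y| <= normc (x - y).
Proof.
rewrite ler_norml lerBlDr lerNl opprB lerBlDr; apply/andP; split.
  by rewrite -(normcN (x - y)) opprB -{1}[y](subrK x) le_normcD.
by rewrite -{1}[x](subrK y) le_normcD.
Qed.

(* Gallagher's inequality for |f y|^2, where f y is the trigonometric polynomial
   at y / M: the increments are split by AM-GM with the weight L = M / (8 N) that
   balances the two Parseval sums. *)
Lemma additive_large_sieve (R : rcfType) (M N H : nat) (z : R[i])
    (a : nat -> R[i]) (P : seq nat) :
  M.-primitive_root z -> (0 < N <= M)%N -> normc (z - 1) <= 8 / M%:R ->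
  uniq P -> {in P, forall x, x + H <= M}%N ->
  {in P &, forall x y, x < y -> x + H <= y}%N ->
  H%:R * \sum_(x <- P) normc (\sum_(n < N) a n * z ^+ (x * n)) ^+ 2 <=
  (M%:R + 16 * N%:R * H%:R) * \sum_(n < N) normc (a n) ^+ 2.
Proof.
move=> zP /andP[N0 NM] zM Pu PM Psep.
pose f y := \sum_(n < N) a n * z ^+ (y * n).
pose A := \sum_(n < N) normc (a n) ^+ 2.
have M0 : 0 < M%:R :> R by rewrite ltr0n (leq_trans N0).
have N0' : 0 < N%:R :> R by rewrite ltr0n.
pose L : R := M%:R / (8 * N%:R).
have L0 : 0 < L by rewrite divr_gt0// mulr_gt0.
have z1 := normc_prim_root zP.
have sumf : \sum_(y < M) normc (f y) ^+ 2 = M%:R * A by rewrite parseval_normc.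
(* Shifting [y] multiplies the coefficients by unimodular numbers, so Parseval gives the same
   value. *)
have sumf1 : \sum_(y < M) normc (f y.+1) ^+ 2 = M%:R * A.
  rewrite -(_ : \sum_(n < N) normc (a n * z ^+ n) ^+ 2 = A); last first.
    by apply: eq_bigr => n _; rewrite normcM normcX z1 expr1n mulr1.
  rewrite -(parseval_normc (fun n => a n * z ^+ n) zP)//.
  apply: eq_bigr => y _; congr (normc _ ^+ 2); apply: eq_bigr => n _.
  by rewrite mulSn exprD mulrA.
(* Differencing multiplies coefficient [n] by [z ^+ n - 1], of modulus at most 8 N / M: here [z]
   must be close to 1. *)
have sumdf : \sum_(y < M) normc (f y.+1 - f y) ^+ 2 <=
    M%:R * ((8 * N%:R / M%:R) ^+ 2 * A).
  have df y : f y.+1 - f y = \sum_(n < N) (a n * (z ^+ n - 1)) * z ^+ (y * n).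
    rewrite -sumrB; apply: eq_bigr => n _.
    by rewrite mulSn exprD; ring.
  under eq_bigr do rewrite df.
  rewrite (parseval_normc (fun n => a n * (z ^+ n - 1)) zP)// ler_pM2l//.
  rewrite /A big_distrr /=; apply: ler_sum => n _.
  rewrite normcM exprMn mulrC ler_wpM2r ?sqr_ge0// ler_sqr ?nnegrE ?normc_ge0 ?divr_ge0 ?mulr_ge0//.
  apply: le_trans (normc_exprB1_le _ z1) _.
  rewrite [8 * _]mulrC -mulrA ler_pM ?normc_ge0// ler_nat; exact: ltnW.
have g0 y : 0 <= normc (f y) ^+ 2 by rewrite sqr_ge0.
apply: le_trans (discrete_gallagher g0 Pu PM Psep) _.
rewrite sumf -/A mulrDl lerD2l [16 * _ * _]mulrC -mulrA ler_wpM2l//.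
(* For this [L] each of the two terms is 8 N A, whence the constant 16. *)
rewrite (_ : _ * A = L * (M%:R * ((8 * N%:R / M%:R) ^+ 2 * A)) +
    (M%:R * A + M%:R * A) / (2 * L)); last first.
  by rewrite /L; field; rewrite !gt_eqF.
apply: le_trans (_ : \sum_(y < M) (L * normc (f y.+1 - f y) ^+ 2 +
   (normc (f y.+1) ^+ 2 + normc (f y) ^+ 2) / (2 * L)) <= _).
  apply: ler_sum => y _; apply: dist_sqr_le; rewrite ?normc_ge0//.
  exact: normc_dist.
rewrite big_split /= -big_distrr -big_distrl /= big_split /= sumf sumf1.
by rewrite lerD2r ler_wpM2l// ltW.
Qed.

(* M is such that every fraction b / p with p <= Q is a grid point y / M, and
   distinct ones are at least M / Q ^ 2 grid steps apart. *)
Lemma farey_large_sieve (R : rcfType) (Q N M : nat) (z : R[i]) (a : nat -> R[i]) :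
  (0 < N)%N -> (0 < Q)%N -> M = (Q ^ 2 * (Q`! * N))%N ->
  M.-primitive_root z -> normc (z - 1) <= 8 / M%:R ->
  \sum_(0 <= p < Q.+1 | prime p) \sum_(1 <= b < p)
     normc (\sum_(n < N) a n * z ^+ (b * (M %/ p) * n)) ^+ 2 <=
  (Q%:R ^+ 2 + 16 * N%:R) * \sum_(n < N) normc (a n) ^+ 2.
Proof.
move=> N0 Q0 ME zP zM; set H := (Q`! * N)%N in ME.
have H0 : (0 < H)%N by rewrite muln_gt0 fact_gt0.
pose ps := [seq p <- index_iota 0 Q.+1 | prime p].
pose P := [seq (b * (M %/ p))%N | p <- ps, b <- index_iota 1 p].
have psP p : p \in ps -> prime p /\ (p <= Q)%N.
  by rewrite mem_filter mem_index_iota => /andP[-> /andP[_]].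
have pM p : p \in ps -> (M %/ p * p)%N = M.
  move=> /psP[pp pQ]; rewrite divnK// ME dvdn_mull// dvdn_mulr// dvdn_fact//.
  by rewrite prime_gt0.
have HM p q : (p <= Q)%N -> (q <= Q)%N -> (H * (p * q) <= M)%N.
  by move=> pQ qQ; rewrite ME mulnC leq_mul2r expnS expn1 leq_mul ?orbT.
have M0 : (0 < M)%N by rewrite ME muln_gt0 expn_gt0 Q0 H0.
(* If b / p = c / q then [p] divides b q, hence [q] because 0 < b < p; so p = q and b = c. *)
have Pu : uniq P.
  apply: allpairs_uniq_dep => [|p _|]; rewrite ?filter_uniq ?iota_uniq//.
  move=> [p b] [q c] /allpairsPdep[p' [b' [p'P b'P [-> ->]]]].
  move=> /allpairsPdep[q' [c' [q'P c'P [-> ->]]]] /= E.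
  have [pp pQ] := psP _ p'P; have [qq qQ] := psP _ q'P.
  move: b'P c'P; rewrite !mem_index_iota => /andP[b0 bp] /andP[c0 cq].
  have {}E : (b' * q' = c' * p')%N.
    apply/eqP; rewrite -(eqn_pmul2r M0); apply/eqP.
    move: (pM _ p'P) (pM _ q'P) E; move: (M %/ p')%N (M %/ q')%N => u v hu hv E.
    by rewrite -{1}hu -hv mulnACA E [RHS]mulnACA [(q' * p')%N]mulnC.
  have : (p' %| b' * q')%N by rewrite E dvdn_mull.
  rewrite Euclid_dvdM// => /orP[/dvdn_leq|]; first by lia.
  rewrite dvdn_prime2// => /eqP pq; rewrite -pq in E *.
  congr Tagged; move/eqP: E; rewrite eqn_pmul2r ?prime_gt0//; exact/eqP.
have PE x : x \in P -> exists p b,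
    [/\ p \in ps, (0 < b < p)%N, x = (b * (M %/ p))%N & (x * p = b * M)%N].
  move=> /allpairsPdep[p [b [pP bP ->]]]; exists p, b.
  by split=> //; [rewrite mem_index_iota in bP|rewrite -mulnA pM].
have PM : {in P, forall x, x + H <= M}%N.
  move=> x /PE[p [b [pP /andP[b0 bp] _ xE]]]; have [pp pQ] := psP _ pP.
  rewrite -(leq_pmul2r (prime_gt0 pp)) mulnDl xE.
  have := HM p 1%N pQ Q0; rewrite muln1; nia.
(* Here c p - b q >= 1, so the fractions differ by at least 1 / (p q), that is, by M / (p q) >= H
   grid steps. *)
have Psep : {in P &, forall x y, x < y -> x + H <= y}%N.
  move=> x y /PE[p [b [pP /andP[b0 bp] _ xE]]] /PE[q [c [qP /andP[c0 cq] _ yE]]] xy.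
  have [pp pQ] := psP _ pP; have [qq qQ] := psP _ qP.
  have p0 := prime_gt0 pp; have q0 := prime_gt0 qq.
  have hM := HM p q pQ qQ.
  have lt1 : (b * q < c * p)%N.
    rewrite -(ltn_pmul2r M0) -mulnA (mulnC q) mulnA -xE -(mulnA c) (mulnC p) mulnA -yE.
    by rewrite -!mulnA (mulnC q) ltn_pmul2r// muln_gt0 p0.
  rewrite -(leq_pmul2r (m := (p * q)%N)) ?muln_gt0 ?p0// mulnDl.
  apply: (@leq_trans (b * q * M + M)).
    by rewrite mulnA xE; nia.
  by rewrite (mulnC p) mulnA yE; nia.
(* The factor [N] of [M] is there for this inequality, which Parseval on the grid requires. *)
have NM : (0 < N <= M)%N.
  by rewrite N0 ME mulnA leq_pmull// muln_gt0 expn_gt0 Q0 fact_gt0.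
have := additive_large_sieve a zP NM zM Pu PM Psep.
rewrite big_allpairs_dep big_filter /= => LS.
rewrite -(ler_pM2l (x := H%:R)) ?ltr0n//; apply: le_trans LS _.
rewrite mulrA ler_wpM2r ?sumr_ge0// => [*|]; first exact: sqr_ge0.
by rewrite ME natrM natrX mulrDr [H%:R * (16 * _)]mulrC [H%:R * _]mulrC.
Qed.

(** ** The multiplicative large sieve for prime moduli *)

Lemma bessel (C : numClosedFieldType) (T : finType) (I : eqType) (s : seq I)
    (u : I -> T -> C) (c : C) (f : T -> C) :
  0 < c -> uniq s ->
  {in s &, forall i j, \sum_t u i t * (u j t)^* = (i == j)%:R * c} ->
  \sum_(i <- s) `|\sum_t u i t * f t| ^+ 2 <= c * \sum_t `|f t| ^+ 2.
Proof.
move=> c0 su orth; pose b i := \sum_t u i t * f t.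
pose B := \sum_(i <- s) `|b i| ^+ 2.
pose e t := c^-1 * \sum_(i <- s) b i * (u i t)^*.
have ccj : (c^-1)^* = c^-1 by rewrite conj_Creal// ger0_real// invr_ge0 ltW.
have Breal : B^* = B by rewrite conj_Creal// ger0_real// sumr_ge0// => i _; rewrite exprn_ge0.
have eE t : (e t)^* = c^-1 * \sum_(j <- s) (b j)^* * u j t.
  rewrite /e rmorphM rmorph_sum /= ccj; congr (_ * _); apply: eq_bigr => j _.
  by rewrite rmorphM /= conjCK.
have ef : \sum_t e t * (f t)^* = c^-1 * B.
  under eq_bigr do rewrite -mulrA big_distrl /=.
  rewrite -big_distrr exchange_big /=; congr (_ * _); apply: eq_bigr => i _.
  rewrite normCK rmorph_sum big_distrr /=; apply: eq_bigr => t _.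
  by rewrite rmorphM /= mulrA.
have ee : \sum_t e t * (e t)^* = c^-1 * B.
  under eq_bigr do rewrite -mulrA big_distrl /=.
  rewrite -big_distrr exchange_big /=; congr (_ * _); apply: eq_big_seq => i iS.
  under eq_bigr do rewrite eE mulrCA -mulrA 2!big_distrr /=.
  rewrite -big_distrr exchange_big /= normCK.
  transitivity (c^-1 * (b i * \sum_(j <- s) (b j)^* * ((i == j)%:R * c))).
    congr (_ * _); rewrite big_distrr; apply: eq_big_seq => j jS /=.
    rewrite eq_sym -orth// 2!big_distrr /=; apply: eq_bigr => t _.
    by ring.
  rewrite (bigD1_seq i)//= eqxx mul1r big1 ?addr0 => [|j ji].
    by field; rewrite gt_eqF.
  by rewrite eq_sym (negbTE ji) mul0r mulr0.
have fe : \sum_t f t * (e t)^* = c^-1 * B.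
  rewrite -[RHS]conjCK rmorphM /= ccj Breal -ef rmorph_sum.
  by apply: eq_bigr => t _; rewrite [RHS]rmorphM /= conjCK mulrC.
(* e is the orthogonal projection of f on the span of the u i *)
have : 0 <= \sum_t `|f t - e t| ^+ 2 by rewrite sumr_ge0// => t _; rewrite exprn_ge0.
have -> : \sum_t `|f t - e t| ^+ 2 = \sum_t `|f t| ^+ 2 - c^-1 * B.
  rewrite -[in RHS]ef -sumrB -[RHS]addr0 -[X in _ + X](subrr (c^-1 * B)).
  rewrite -{1}ee -fe -sumrB -big_split /=; apply: eq_bigr => t _.
  by rewrite !normCK rmorphB /=; ring.
by rewrite subr_ge0 ler_pdivrMl.
Qed.

Lemma dirichlet_character_eq0 (R : realType) (p : nat) (chi : {ffun 'F_p -> R[i]}) h :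
  dirichlet_character chi -> (chi h == 0) = (h == 0).
Proof.
move=> [_ chiU]; apply/idP/idP => [/eqP c0|/eqP ->].
  by apply: contraT; rewrite -unitfE => /chiU; rewrite c0 eqxx.
by apply: contraT => /chiU; rewrite unitr0.
Qed.

(** Since [h ^+ #|'F_p| = h], a nonzero value [chi h] is a root of unity. *)
Lemma dirichlet_character_norm (R : realType) (p : nat) (chi : {ffun 'F_p -> R[i]}) h :
  dirichlet_character chi -> `|chi h| = (h != 0)%:R.
Proof.
move=> chiD; have [->|h0] := eqVneq h 0.
  by apply/eqP; rewrite normr_eq0 dirichlet_character_eq0.
have c0 : chi h != 0 by rewrite dirichlet_character_eq0.
have chiX n : chi (h ^+ n) = chi h ^+ n.
  by case: (chiD) => -[c1 cM] _; elim: n => [|n IH]; rewrite ?expr0// !exprS cM IH.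
have : chi h ^+ #|'F_p| = chi h by rewrite -chiX expf_card.
rewrite -(ltn_predK (finNzRing_gt1 'F_p)) exprS -[RHS]mulr1 => /(mulfI c0) E.
apply/eqP; rewrite -(pexpr_eq1 (n := #|'F_p|.-1))// -?normrX ?E ?normr1//.
by have := finNzRing_gt1 'F_p; case: #|_| => [|[]].
Qed.

Lemma dirichlet_character_orth (R : realType) (p : nat)
    (chi psi : {ffun 'F_p -> R[i]}) : prime p ->
  dirichlet_character chi -> dirichlet_character psi ->
  \sum_h chi h * (psi h)^* = (chi == psi)%:R * (p.-1)%:R.
Proof.
move=> pp chiD psiD; have [->|neq] := eqVneq chi psi.
  under eq_bigr do rewrite -normCK dirichlet_character_norm//.
  rewrite mul1r (bigD1 0)//= expr0n add0r.
  under eq_bigr => h -> do rewrite expr1n.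
  by rewrite sumr_const cardC1 card_Fp.
have [u cpu] : exists u, chi u != psi u.
  apply/existsP; apply: contraT; rewrite negb_exists => /forallP E.
  by case/eqP: neq; apply/ffunP => u; apply/eqP; have := E u; rewrite negbK.
have u0 : u != 0.
  apply: contra cpu => /eqP ->; rewrite eq_sym; apply/eqP.
  transitivity (0 : R[i]); last apply/esym; apply/eqP;
    by rewrite dirichlet_character_eq0.
set S := \sum_h _; rewrite mul0r.
have psiu : psi u * (psi u)^* = 1 by rewrite -normCK dirichlet_character_norm// u0 expr1n.
(* Replacing [h] by [u * h] multiplies the sum by this factor, which is not 1 by the choice of
   [u]. *)
have SE : chi u * (psi u)^* * S = S.
  rewrite [RHS](reindex_inj (mulfI u0)) /= big_distrr /=; apply: eq_bigr => h _.
  by rewrite (proj1 chiD).2 (proj1 psiD).2 rmorphM /=; ring.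
apply/eqP; have /eqP : (chi u - psi u) * (psi u)^* * S = 0.
  by rewrite mulrBl psiu mulrBl SE mul1r subrr.
by rewrite !mulf_eq0 subr_eq0 (negbTE cpu) conjC_eq0 dirichlet_character_eq0// (negbTE u0).
Qed.

Lemma principal_dirichlet (R : realType) (p : nat) :
  dirichlet_character (principal_character R p).
Proof.
split=> [|a]; last by rewrite ffunE pnatr_eq0 eqb0 negbK.
split=> [|a b]; rewrite !ffunE ?unitr1//.
by rewrite unitrM -natrM mulnb.
Qed.

Lemma sum_nonprincipal (R : realType) (p : nat) (chi : {ffun 'F_p -> R[i]}) :
  prime p -> dirichlet_character chi -> chi != principal_character R p ->
  \sum_h chi h = 0.
Proof.
move=> pp chiD chi0.
have := dirichlet_character_orth pp chiD (principal_dirichlet R p).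
rewrite (negbTE chi0) mul0r => E; rewrite -[RHS]E; apply: eq_bigr => h _.
rewrite ffunE conjC_nat unitfE; have [->|] := eqVneq h 0; last by rewrite mulr1.
by rewrite mulr0; apply/eqP; rewrite dirichlet_character_eq0.
Qed.

Lemma sum_Fp (V : nmodType) (p : nat) (G : nat -> V) : prime p ->
  \sum_(h : 'F_p) G h = \sum_(n < p) G n.
Proof.
by move=> pp; rewrite -[RHS](big_mkord xpredT G) -[in RHS](Fp_cast pp) big_mkord.
Qed.

(** Both sides are compared with [p] times the sum of squares of the residue class sums [Z r],
    centred at their mean: Bessel bounds the character side by it, Parseval identifies it with the
    additive side. *)
Lemma sum_characters_le (R : realType) (p N : nat) (w : R[i]) (a : nat -> R[i])
    (s : seq {ffun 'F_p -> R[i]}) :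
  prime p -> p.-primitive_root w -> uniq s ->
  (forall chi, chi \in s ->
    dirichlet_character chi /\ chi != principal_character R p) ->
  \sum_(chi <- s) normc (\sum_(n < N) a n * chi n%:R) ^+ 2 <=
  \sum_(1 <= b < p) normc (\sum_(n < N) a n * w ^+ (b * n)) ^+ 2.
Proof.
move=> pp wP su sD.
pose Z r := \sum_(n < N | (n %% p == r)%N) a n.
have p0 : p%:R != 0 :> R[i] by rewrite pnatr_eq0 -lt0n prime_gt0.
(* Subtracting the mean c changes no nonprincipal character sum and removes the
   zero frequency, so that no Gauss sum is needed. *)
pose c := p%:R^-1 * \sum_(n < N) a n.
have sumZ (g : nat -> R[i]) : \sum_(r < p) Z r * g r = \sum_(n < N) a n * g (n %% p)%N.
  under eq_bigr do rewrite big_distrl /= big_mkcond /=.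
  rewrite exchange_big /=; apply: eq_bigr => n _.
  rewrite -big_mkcond /= (big_pred1 (Ordinal (ltn_pmod n (prime_gt0 pp))))//=.
have chiE chi : chi \in s ->
    \sum_(n < N) a n * chi n%:R = \sum_(h : 'F_p) chi h * (Z h - c).
  move=> /sD[chiD chi0]; under [RHS]eq_bigr do rewrite mulrBr.
  rewrite sumrB -big_distrl /= sum_nonprincipal// mul0r subr0.
  transitivity (\sum_(r < p) Z r * chi r%:R).
    rewrite (sumZ (fun r => chi r%:R)); apply: eq_bigr => n _; congr (_ * chi _).
    by apply: val_inj; rewrite /= !val_Fp_nat// modn_mod.
  rewrite -(sum_Fp (fun r => Z r * chi r%:R))//; apply: eq_bigr => h _.
  by rewrite natr_Zp mulrC.
have bessel_s : \sum_(chi <- s) `|\sum_(h : 'F_p) chi h * (Z h - c)| ^+ 2 <=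
    p%:R * \sum_(n < p) `|Z n - c| ^+ 2.
  apply: (@le_trans _ _ ((p.-1)%:R * \sum_(h : 'F_p) `|Z h - c| ^+ 2)).
    apply: (bessel (u := fun (chi : {ffun 'F_p -> R[i]}) h => chi h)) => //.
      by rewrite ltr0n -subn1 subn_gt0 prime_gt1.
    by move=> chi psi /sD[chiD _] /sD[psiD _]; exact: dirichlet_character_orth.
  rewrite (sum_Fp (fun n => `|Z n - c| ^+ 2))// ler_wpM2r ?ler_nat ?leq_pred//.
  by rewrite sumr_ge0// => n _; rewrite exprn_ge0.
rewrite -lecR !rmorph_sum /=.
under eq_bigr do rewrite -normC_sqr; under [leRHS]eq_bigr do rewrite -normC_sqr.
rewrite (eq_big_seq _ (fun chi chiS => congr1 (fun t => `|t| ^+ 2) (chiE chi chiS))).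
apply: le_trans bessel_s _; rewrite -(parseval (fun n => Z n - c) wP).
rewrite -(big_mkord xpredT (fun y => `|\sum_(n < p) (Z n - c) * w ^+ (y * n)| ^+ 2)).
rewrite big_ltn ?prime_gt0//= [X in X + _](_ : _ = 0) ?add0r; last first.
  under eq_bigr do rewrite mul0n expr0 mulr1.
  rewrite sumrB sumr_const card_ord -mulr_natl mulVKf//.
  have := sumZ (fun=> 1); under eq_bigr do rewrite mulr1; move=> ->.
  by under eq_bigr do rewrite mulr1; rewrite subrr normr0 expr0n.
rewrite le_eqVlt; apply/orP; left; apply/eqP; apply: eq_big_nat => b /andP[b0 bp]; congr (`|_| ^+ 2).
have geo : \sum_(n < p) w ^+ (b * n) = 0.
  under eq_bigr do rewrite exprM; apply: sum_expr_unity.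
    by rewrite exprAC (prim_expr_order wP) expr1n.
  by rewrite -(prim_order_dvd wP) gtnNdvd.
under eq_bigr do rewrite mulrBl.
rewrite sumrB -big_distrr /= geo mulr0 subr0 (sumZ (fun r => w ^+ (b * r))).
apply: eq_bigr => n _; congr (_ * _).
by rewrite !(mulnC b) !exprM (prim_expr_mod wP).
Qed.

(** ** Multiplicities of products and the divisor bound *)

Local Open Scope nat_scope.

(** Raise a + 1 <= j (a %/ j + 1) <= j 2^(a %/ j) to the power [j]. *)
Lemma succn_exp_le j a : 0 < j -> a.+1 ^ j <= j ^ j * 2 ^ a.
Proof.
move=> j0; apply: (@leq_trans ((j * (a %/ j).+1) ^ j)).
  by rewrite leq_exp2r// {1}(divn_eq a j) mulnC mulnS addnC ltn_add2r ltn_pmod.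
rewrite expnMn leq_mul2l; apply/orP; right.
apply: (@leq_trans ((2 ^ (a %/ j)) ^ j)); first by rewrite leq_exp2r// ltn_expl.
by rewrite -expnM leq_exp2l// leq_trunc_div.
Qed.

(** A divisor is recovered from its [p]-adic valuation and its part prime to [p]; this strips one
    prime in the induction below. *)
Lemma size_divisors_le n p : 0 < n -> prime p ->
  size (divisors n) <= (logn p n).+1 * size (divisors n`_p^').
Proof.
move=> n0 pp.
rewrite -[(logn p n).+1](size_iota 0) -(size_allpairs (fun i e => p ^ i * e)).
apply: uniq_leq_size => [|d]; first exact: divisors_uniq.
rewrite -dvdn_divisors// => dn; have d0 := dvdn_gt0 n0 dn.
apply/allpairsP; exists (logn p d, d`_p^'); split.
- by rewrite mem_iota /= add0n ltnS dvdn_leq_log.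
- by rewrite -dvdn_divisors ?part_gt0// partn_dvd.
- by rewrite -p_part partnC.
Qed.

(* A prime power q ^ a contributes (a + 1) ^ j <= 2 ^ (a j), which is at most
   q ^ a unless q < 2 ^ j; each of the few small primes costs a factor j ^ j. *)
Lemma size_divisors_exp_le_prod j n : 0 < j -> 0 < n ->
  size (divisors n) ^ j <=
  (\prod_(q <- primes n) (if q < 2 ^ j then j ^ j else 1)) * n.
Proof.
move=> j0; elim/ltn_ind: n => n IH n0.
have [->|n1] := eqVneq n 1; first by rewrite big_nil exp1n.
have n2 : 1 < n by case: n n0 n1 {IH} => [|[]].
set p := pdiv n; have pp : prime p by rewrite pdiv_prime.
set m := n`_p^'; have m0 : 0 < m by rewrite part_gt0.
have nE : p ^ logn p n * m = n by rewrite -p_part partnC.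
have pn : p \in primes n by rewrite mem_primes pp n0 pdiv_dvd.
have ln0 : 0 < logn p n by rewrite logn_gt0.
have mn : m < n.
  rewrite -[X in _ < X]nE -{1}[m]mul1n ltn_pmul2r// -(exp1n (logn p n)).
  by rewrite ltn_exp2r// prime_gt1.
rewrite (bigD1_seq p)//= ?primes_uniq//.
have -> : \prod_(q <- primes n | q != p) (if q < 2 ^ j then j ^ j else 1) =
    \prod_(q <- primes m) (if q < 2 ^ j then j ^ j else 1).
  by rewrite primes_part big_filter; apply: eq_bigl => q; rewrite !inE.
apply: leq_trans (_ : ((logn p n).+1 * size (divisors m)) ^ j <= _).
  by rewrite leq_exp2r// size_divisors_le.
rewrite expnMn -{2}nE mulnACA; apply: leq_mul; last exact: IH.
case: ifP => [_|/negbT]; last rewrite -leqNgt mul1n => pj.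
  apply: leq_trans (succn_exp_le _ j0) _.
  by rewrite leq_mul2l leq_exp2r// prime_gt1// orbT.
apply: (@leq_trans ((2 ^ (logn p n)) ^ j)); first by rewrite leq_exp2r// ltn_expl.
by rewrite -expnM mulnC expnM leq_exp2r.
Qed.

(** The divisor bound tau(n) = O(n^(1/j)), raised to the power [j] to stay in the natural numbers;
    the exponent [2 ^ j] overcounts the primes below [2 ^ j]. *)
Lemma size_divisors_exp_le j n : 0 < j -> 0 < n ->
  size (divisors n) ^ j <= (j ^ j) ^ (2 ^ j) * n.
Proof.
move=> j0 n0; apply: leq_trans (size_divisors_exp_le_prod j0 n0) _.
rewrite leq_mul2r; apply/orP; right.
rewrite -big_mkcond -big_filter big_const_seq count_predT -Monoid.iteropE.
rewrite -/(expn _ _).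
rewrite leq_pexp2l ?expn_gt0 ?j0// -[leqRHS](size_iota 0).
apply: uniq_leq_size => [|q]; first by rewrite filter_uniq ?primes_uniq.
by rewrite mem_filter mem_iota => /andP[].
Qed.

(** The coefficient d(n) of the overview. The ordinal [f j] stands for the factor [f j + 1], so that
    factors run from 1 to [m]. *)
Definition num_factorizations (k m n : nat) : nat :=
  #|[set f : {ffun 'I_k -> 'I_m} | \prod_j (f j).+1 == n]|.

(** Every factor divides [n], so a factorization is a [k]-tuple of divisors. *)
Lemma num_factorizations_le k m n : 0 < n ->
  num_factorizations k m n <= size (divisors n) ^ k.
Proof.
move=> n0; pose D := [set i : 'I_m | i.+1 %| n].
apply: (@leq_trans (#|D| ^ k)).
  have -> : #|D| ^ k = #|D| ^ #|'I_k| by rewrite card_ord.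
  rewrite -card_ffun_on; apply/subset_leq_card/fintype.subsetP => f.
  rewrite inE => /eqP fn; apply/ffun_onP => j; rewrite inE -fn.
  by rewrite (bigD1 j)//= dvdn_mulr.
case: k => // k; rewrite leq_exp2r// cardE -(size_map (fun i : 'I_m => i.+1)).
apply: uniq_leq_size => [|_ /mapP[i iD ->]].
  by rewrite map_inj_uniq ?enum_uniq// => i i' [/val_inj].
by move: iD; rewrite mem_enum inE -dvdn_divisors.
Qed.

Lemma prod_succ_bounds k m (f : {ffun 'I_k -> 'I_m}) :
  0 < \prod_j (f j).+1 <= m ^ k.
Proof.
rewrite prodn_gt0//=.
have -> : m ^ k = \prod_(j < k) m by rewrite prod_nat_const card_ord.
by apply: leq_prod => j _; apply: ltn_ord.
Qed.

Lemma sum_num_factorizations k m :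
  \sum_(n < (m ^ k).+1) num_factorizations k m n = m ^ k.
Proof.
transitivity #|{ffun 'I_k -> 'I_m}|; last by rewrite card_ffun !card_ord.
rewrite -sum1_card (partition_big (fun f : {ffun 'I_k -> 'I_m} =>
   inord (\prod_j (f j).+1) : 'I_(m ^ k).+1) xpredT)//=.
apply: eq_bigr => n _; rewrite sum1_card; apply: eq_card => f.
rewrite inE unfold_in /= inordK//.
by have /andP[] := prod_succ_bounds f.
Qed.

(** Expand over [k]-tuples, merge each term by complete multiplicativity, and group the tuples by
    their product. *)
Lemma expr_char_sum (F : comNzRingType) (k m : nat) (chi : nat -> F) :
  chi 1 = 1%R -> {morph chi : x y / x * y >-> (x * y)%R} ->
  ((\sum_(i < m) chi i.+1) ^+ k =
   \sum_(n < (m ^ k).+1) (num_factorizations k m n)%:R * chi n)%R.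
Proof.
move=> c1 cM.
transitivity (\sum_(f : {ffun 'I_k -> 'I_m}) chi (\prod_j (f j).+1)%N)%R.
  have -> : (forall x : F, x ^+ k = \prod_(j < k) x)%R.
    by move=> x; rewrite prodr_const card_ord.
  rewrite bigA_distr_bigA /=.
  by apply: eq_bigr => f _; rewrite (big_morph chi cM c1).
rewrite (partition_big (fun f : {ffun 'I_k -> 'I_m} =>
   inord (\prod_j (f j).+1) : 'I_(m ^ k).+1) xpredT)//=.
apply: eq_bigr => n _; rewrite mulr_natl -sumr_const.
apply: eq_big => [f|f /eqP <-].
  rewrite !inE -val_eqE /= inordK//.
  by have /andP[] := prod_succ_bounds f.
rewrite inordK//.
by have /andP[] := prod_succ_bounds f.
Qed.

Local Open Scope ring_scope.

(** ** Moments of incomplete character sums *)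

Lemma sin_le_id (R : realType) (x : R) : 0 <= x -> sin x <= x.
Proof.
move=> x0; have [c _ cE] := MVT_segment x0
  (fun y _ => is_derive_sin y) (continuous_subspaceT (@continuous_sin R)).
move: cE; rewrite sin0 !subr0 => ->.
by rewrite ler_piMl// cos_le1.
Qed.

(** The witness is exp(2 pi i / M). With t = pi / M its distance to 1 is 2 sin t <= 2 t, and pi < 4
    gives the 8. *)
Lemma exists_prim_root_near1 (R : realType) (M : nat) : (0 < M)%N ->
  exists2 z : R[i], M.-primitive_root z & normc (z - 1) <= 8 / M%:R.
Proof.
move=> M0; have M0' : 0 < M%:R :> R by rewrite ltr0n.
pose t : R := pi / M%:R.
have t0 : 0 < t by rewrite divr_gt0 ?pi_gt0.
pose z : R[i] := Complex (cos (t *+ 2)) (sin (t *+ 2)).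
have zX n : z ^+ n = Complex (cos (t *+ 2 *+ n)) (sin (t *+ 2 *+ n)).
  elim: n => [|n IH]; first by rewrite expr0 mulr0n cos0 sin0.
  rewrite exprSr IH [t *+ 2 *+ n.+1]mulrSr (cosD (t *+ 2 *+ n)).
  by rewrite (sinD (t *+ 2 *+ n)) [sin _ * cos _ + _]addrC.
have cosE x : cos (x *+ 2) = 1 - (sin x ^+ 2) *+ 2 :> R.
  by rewrite cos_mulr2n cos2sin2; ring.
exists z.
  apply/andP; split=> //; apply/forallP => -[i iM] /=; rewrite unity_rootE zX.
  have [iE|iN] := eqVneq i.+1 M.
    rewrite iE mulrnAC -[t *+ M]mulr_natr /t divfK ?lt0r_neq0//.
    by rewrite cos2pi sin2pi eqxx.
  (* The real part is 1 - 2 sin((i + 1) t)^2, and the sine is nonzero because 0 < (i + 1) t < pi. *)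
  apply/eqP/negbTE; rewrite eq_complex /= mulrnAC cosE negb_and.
  apply/orP; left; rewrite -subr_eq0 addrAC subrr add0r oppr_eq0 mulrn_eq0 /=.
  rewrite sqrf_eq0 gt_eqF// sin_gt0_pi// pmulrn_lgt0// t0 /=.
  rewrite -mulr_natr /t mulrAC ltr_pdivrMr// ltr_pM2l ?pi_gt0// ltr_nat.
  by rewrite ltn_neqAle iN.
rewrite -[leRHS]ger0_norm ?divr_ge0// -sqrtr_sqr /normc /= ler_wsqrtr//.
have -> : (cos (t *+ 2) - 1) ^+ 2 + (sin (t *+ 2) - 0) ^+ 2 = 4 * sin t ^+ 2.
  by rewrite subr0 sin2cos2 cosE; ring.
have st0 : 0 <= sin t.
  rewrite sin_ge0_pi// ltW//= ler_pdivrMr// ler_peMr ?pi_ge0//.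
  by rewrite (ler_nat R 1).
have st : sin t <= 4 / M%:R.
  apply: le_trans (sin_le_id (ltW t0)) _; rewrite /t ler_wpM2r ?invr_ge0 ?ler0n//.
  by have := pihalf_lt2 R; lra.
have -> : 8 / M%:R = 2 * (4 / M%:R) :> R by ring.
by rewrite exprMn; nra.
Qed.

(** One [z] serves all moduli: [z ^+ (M %/ p)] is the primitive [p]-th root of unity fed to
    [sum_characters_le]. *)
Lemma multiplicative_large_sieve (R : realType) (Q N : nat) (a : nat -> R[i])
    (s : forall p, seq {ffun 'F_p -> R[i]}) : (0 < Q)%N -> (0 < N)%N ->
  (forall p, prime p -> uniq (s p)) ->
  (forall p chi, prime p -> chi \in s p ->
    dirichlet_character chi /\ chi != principal_character R p) ->
  \sum_(p < Q.+1 | prime p) \sum_(chi <- s p)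
     normc (\sum_(n < N) a n * chi n%:R) ^+ 2 <=
  (Q%:R ^+ 2 + 16 * N%:R) * \sum_(n < N) normc (a n) ^+ 2.
Proof.
move=> Q0 N0 su sD; pose M := (Q ^ 2 * (Q`! * N))%N.
have M0 : (0 < M)%N by rewrite muln_gt0 expn_gt0 Q0 muln_gt0 fact_gt0.
have [z zP zM] := exists_prim_root_near1 R M0.
apply: le_trans (farey_large_sieve a N0 Q0 erefl zP zM); rewrite big_mkord.
apply: ler_sum => p pp; have pQ : (p <= Q)%N by rewrite -ltnS.
have pM : (p %| M)%N by rewrite dvdn_mull// dvdn_mulr// dvdn_fact// prime_gt0.
apply: le_trans (sum_characters_le N a pp (dvdn_prim_root zP pM) (su _ pp) (fun chi => sD _ chi pp)) _.
rewrite le_eqVlt; apply/orP; left; apply/eqP; apply: eq_bigr => b _.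
congr (normc _ ^+ 2); apply: eq_bigr => n _.
by rewrite -exprM; congr (_ * _ ^+ _); ring.
Qed.

Lemma character_sum_moment (R : realType) (Q k m D : nat)
    (s : forall p, seq {ffun 'F_p -> R[i]}) : (0 < Q)%N -> (0 < m)%N ->
  (forall p, prime p -> uniq (s p)) ->
  (forall p chi, prime p -> chi \in s p ->
    dirichlet_character chi /\ chi != principal_character R p) ->
  (forall n, n <= m ^ k -> 0 < n -> num_factorizations k m n <= D)%N ->
  \sum_(p < Q.+1 | prime p) \sum_(chi <- s p)
     normc (\sum_(n < m) chi n.+1%:R) ^+ (2 * k) <=
  (Q%:R ^+ 2 + 32 * m%:R ^+ k) * (D%:R * m%:R ^+ k).
Proof.
move=> Q0 m0 su sD dD; pose a n : R[i] := (num_factorizations k m n)%:R.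
(* [D] bounds the multiplicities of positive [n] only, while the sieve sum starts at 0. *)
have nfc0 : num_factorizations k m 0 = 0%N.
  apply/eqP; rewrite cards_eq0; apply/eqP/setP => f; rewrite !inE.
  by have /andP[] := prod_succ_bounds f; rewrite lt0n => /negbTE ->.
rewrite [leLHS](_ : _ = \sum_(p < Q.+1 | prime p) \sum_(chi <- s p)
     normc (\sum_(n < (m ^ k).+1) a n * chi n%:R) ^+ 2); last first.
  apply: eq_bigr => p pp; apply: eq_big_seq => chi /(sD _ _ pp)[[[c1 cM] _] _].
  rewrite mulnC exprM -normcX.
  rewrite (expr_char_sum k m (chi := fun n => chi n%:R))// => x y /=.
  by rewrite natrM cM.
apply: le_trans (multiplicative_large_sieve a Q0 (ltn0Sn _) su sD) _.
apply: ler_pM.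
- by rewrite addr_ge0 ?mulr_ge0 ?exprn_ge0.
- by rewrite sumr_ge0// => n _; rewrite exprn_ge0// normc_ge0.
(* The sieve length is m^k + 1 <= 2 m^k, which turns 16 into 32. *)
- rewrite lerD2l -natrX (_ : 32 = 16 * 2) -?mulrA; last by rewrite -natrM.
  rewrite ler_pM2l// -natrM ler_nat mul2n -addnn -addn1 leq_add2l.
  by rewrite expn_gt0 m0.
have normc_nat (n : nat) : normc (n%:R : R[i]) = n%:R.
  by rewrite -(normc1 R) -normcMn.
under eq_bigr do rewrite normc_nat.
(* In the sum of squares one factor is bounded by [D] and the other is summed exactly. *)
rewrite -[leRHS](_ : D%:R * \sum_(n < (m ^ k).+1) (num_factorizations k m n)%:R = _).
  rewrite big_distrr /=.
  apply: ler_sum => n _; rewrite expr2 ler_wpM2r// ler_nat.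
  case: (posnP n) => [->|n0]; first by rewrite nfc0.
  by apply: dD => //; rewrite -ltnS.
by rewrite -natr_sum sum_num_factorizations natrX.
Qed.

(** ** From theta values to character sums *)

Local Open Scope classical_set_scope.
Local Open Scope ring_scope.

(* If u diverges, its limit is the junk value 0. *)
Lemma normc_lim_le (R : realType) (u : nat -> R[i]^o) (B : R) : 0 <= B ->
  (\forall n \near \oo, normc (u n) <= B) -> normc (lim (u @ \oo)) <= B.
Proof.
move=> B0 uB; have [cu|/dvgP ->] := pselect (cvg (u @ \oo)); last first.
  by rewrite [point](_ : _ = 0)// normc0.
set l := lim _; rewrite leNgt; apply/negP => Bl.
have e0 : 0 < ((normc l - B)%:C%C : R[i]) by rewrite ltcR subr_gt0.
near \oo => n.
have h1 : normc (u n) <= B by near: n.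
have h2 : `|l - u n| < ((normc l - B)%:C%C : R[i]).
  by near: n; exact: (cvgr_dist_lt u l cu _ e0).
have {h2} : normc (l - u n) < normc l - B by rewrite -ltcR.
have := le_normcD (l - u n) (u n); rewrite subrK; lra.
Unshelve. all: by end_near. Qed.

Lemma abel_summation (F : comPzRingType) (c w : nat -> F) N :
  \sum_(n < N) c n * w n.+1 =
  \sum_(m < N) (\sum_(n < m.+1) c n) * (w m.+1 - w m.+2) + (\sum_(n < N) c n) * w N.+1.
Proof.
elim: N => [|N IH]; first by rewrite !big_ord0 mul0r addr0.
by rewrite !big_ord_recr /= {}IH; ring.
Qed.

Lemma sum_inv_sqr_le (R : realFieldType) N M : (0 < N)%N -> (N < M)%N ->
  \sum_(N.+1 <= n < M) (n%:R ^+ 2)^-1 <= N%:R^-1 - (M.-1)%:R^-1 :> R.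
Proof.
move=> N0; elim: M => // M IH; rewrite ltnS leq_eqVlt => /predU1P[<-|NM].
  by rewrite big_geq// subrr.
rewrite big_nat_recr//=; have := IH NM; have M2 : (1 < M)%N by lia.
suff : (M%:R ^+ 2)^-1 <= (M.-1)%:R^-1 - M%:R^-1 :> R by lra.
case: M M2 {IH NM} => // M M1; rewrite succnK.
have M0 : 0 < M%:R :> R by rewrite ltr0n.
rewrite -[M.+1]addn1 natrD -subr_ge0.
rewrite (_ : _ - _ = (M%:R * (M%:R + 1) ^+ 2)^-1); last first.
  by field; rewrite !gt_eqF ?addr_gt0.
by rewrite invr_ge0 mulr_ge0 ?exprn_ge0 ?addr_ge0 ?ltW.
Qed.

Lemma sqr_half_le_expR (R : realType) (x : R) : 0 <= x -> x ^+ 2 / 2 <= expR x.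
Proof.
by move=> x0; have := expR_ge1Dxn 1 x0; rewrite /= factS /= muln1; lra.
Qed.

(** The factor [* 1] is the argument of [theta 1], kept so that the two summands are convertible. *)
Definition theta_weight (R : realType) (p h n : nat) : R :=
  n%:R ^+ h * expR (- (pi * n%:R ^+ 2 * 1 / p%:R)).

Lemma theta_weight_ge0 (R : realType) p h n : 0 <= theta_weight R p h n.
Proof. by rewrite mulr_ge0 ?exprn_ge0 ?expR_ge0. Qed.

(** With x = pi m^2 / p and [y] the increment of the exponent, exp(-x) (1 - exp(-y)) <= y / x = (2 m
    + 1) / m^2: the modulus cancels. *)
Lemma theta_weight0_diff (R : realType) p m : (0 < p)%N -> (0 < m)%N ->
  0 <= theta_weight R p 0 m - theta_weight R p 0 m.+1 <= 3 / m%:R.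
Proof.
move=> p0 m0; rewrite /theta_weight !expr0 !mul1r mulr1.
have P0 : 0 < p%:R :> R by rewrite ltr0n.
have M0 : 0 < m%:R :> R by rewrite ltr0n.
have M1 : 1 <= m%:R :> R by rewrite (ler_nat R 1).
move: (pi : R) (pi_gt0 R) => c c0.
pose x : R := c * m%:R ^+ 2 / p%:R; pose y : R := c * (2 * m%:R + 1) / p%:R.
have x0 : 0 < x by rewrite divr_gt0// mulr_gt0// exprn_gt0.
have y0 : 0 < y by rewrite divr_gt0// mulr_gt0// addr_gt0// mulr_gt0.
have -> : c * m.+1%:R ^+ 2 * 1 / p%:R = x + y :> R.
  by rewrite -[m.+1]addn1 natrD /x /y; field; rewrite gt_eqF.
rewrite -/x opprD expRD.
have gx0 : 0 < expR (- x) by rewrite expR_gt0.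
have gx : expR (- x) <= x^-1.
  by rewrite expRN lef_pV2 ?posrE ?expR_gt0//; have := expR_ge1Dx x; lra.
have gy : 1 - y <= expR (- y) by have := expR_ge1Dx (- y); lra.
have gy1 : expR (- y) <= 1 by rewrite expRN invf_le1 ?expR_gt0//; have := expR_ge1Dx y; lra.
have yx : y * x^-1 <= 3 / m%:R.
  have -> : y * x^-1 = (2 * m%:R + 1) / m%:R ^+ 2.
    by rewrite /x /y; field; rewrite (gt_eqF P0) (gt_eqF M0) (gt_eqF c0).
  rewrite ler_pdivrMr ?exprn_gt0// mulrAC [_ ^+ 2]expr2 mulrA mulfK ?gt_eqF//; nra.
by nra.
Qed.

(** For h = 1 the difference is m (u - v) - v, where [u] and [v] are the weights for h = 0, m (u -
    v) lies in [0, 3] and [v] in [0, 1]. *)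
Lemma theta_weight_diff (R : realType) p h m : (0 < p)%N -> (0 < m)%N -> (h <= 1)%N ->
  `|theta_weight R p h m - theta_weight R p h m.+1| <= 4 * m%:R ^+ h / m%:R.
Proof.
move=> p0 m0 h1; have /andP[d0 d3] := theta_weight0_diff R p0 m0.
have M0 : 0 < m%:R :> R by rewrite ltr0n.
case: h h1 => [_|[_|//]].
  rewrite ger0_norm// expr0 mulr1; apply: le_trans d3 _.
  by rewrite ler_pM2r ?invr_gt0// ler_nat.
rewrite expr1 mulfK ?gt_eqF//.
have g1 : theta_weight R p 0 m.+1 <= 1.
  rewrite /theta_weight expr0 mul1r -expR0 ler_expR oppr_le0.
  by rewrite divr_ge0 ?mulr_ge0 ?exprn_ge0 ?pi_ge0.
have g0 := theta_weight_ge0 R p 0 m.+1.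
have E n : theta_weight R p 1 n = n%:R * theta_weight R p 0 n.
  by rewrite /theta_weight expr0 mul1r expr1.
rewrite !E -[in m.+1%:R]addn1 natrD.
set u := theta_weight R p 0 m in d0 d3 *; set v := theta_weight R p 0 m.+1 in d0 d3 g1 g0 *.
have md : m%:R * (u - v) <= 3.
  by rewrite mulrC -ler_pdivlMr.
have md0 : 0 <= m%:R * (u - v) by rewrite mulr_ge0 // ltW.
by rewrite ler_norml; apply/andP; split; lra.
Qed.

(** The hypothesis on [N] amounts to N^2 >= 4 Q ln Q. Quadratic decay makes the tail beyond [N]
    summable with a bound free of [p]. *)
Lemma theta_weight_tail (R : realType) Q N p h n : (0 < p <= Q)%N -> (0 < N <= n)%N ->
  (h <= 1)%N -> Q%:R ^+ 2 <= expR (N%:R ^+ 2 / (2 * Q%:R)) :> R ->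
  theta_weight R p h n <= 8 / n%:R ^+ 2.
Proof.
move=> /andP[p0 pQ] /andP[N0 Nn] h1 QN.
have P0 : 0 < p%:R :> R by rewrite ltr0n.
have Q0 : 0 < Q%:R :> R by rewrite ltr0n (leq_trans p0).
have n0 : 0 < n%:R :> R by rewrite ltr0n (leq_trans N0).
have n1 : 1 <= n%:R :> R by rewrite (ler_nat R 1) (leq_trans N0).
pose x : R := n%:R ^+ 2 / (2 * Q%:R).
have x0 : 0 < x by rewrite divr_gt0 ?exprn_gt0 ?mulr_gt0.
have ex : Q%:R ^+ 2 <= expR x.
  apply: le_trans QN _; rewrite ler_expR ler_pM2r ?invr_gt0 ?mulr_gt0//.
  by rewrite ler_sqr ?nnegrE// ler_nat.
(* One factor expR (- x) pays for Q ^ 2, the other one for n ^ 4 / Q ^ 2. *)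
have gle : expR (- (pi * n%:R ^+ 2 * 1 / p%:R)) <= (Q%:R ^+ 2 * (x ^+ 2 / 2))^-1.
  have q0 : 0 < Q%:R ^+ 2 * (x ^+ 2 / 2).
    by apply: mulr_gt0; [|apply: divr_gt0 => //]; exact: exprn_gt0.
  rewrite expRN lef_pV2 ?posrE ?expR_gt0//.
  apply: (@le_trans _ _ (expR x * expR x)).
    apply: ler_pM; [exact: sqr_ge0|by rewrite divr_ge0// sqr_ge0|exact: ex|].
    exact/sqr_half_le_expR/ltW.
  rewrite -expRD ler_expR (_ : x + x = n%:R ^+ 2 / Q%:R); last first.
    by rewrite /x; field; rewrite gt_eqF.
  rewrite mulr1; apply: ler_pM; [exact: sqr_ge0|by rewrite invr_ge0 ltW| |].
    by rewrite ler_peMl ?exprn_ge0//; have := pi_ge2 R; lra.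
  by rewrite lef_pV2 ?posrE// ler_nat.
have gE : (Q%:R ^+ 2 * (x ^+ 2 / 2))^-1 = 8 / n%:R ^+ 4 :> R.
  by rewrite /x; field; rewrite !gt_eqF.
rewrite gE in gle; rewrite /theta_weight.
apply: le_trans (_ : n%:R ^+ 2 * (8 / n%:R ^+ 4) <= _).
  apply: ler_pM => //; rewrite ?exprn_ge0 ?expR_ge0//.
  by rewrite ler_weXn2l// (leq_trans h1).
by rewrite le_eqVlt; apply/orP; left; apply/eqP; field; rewrite gt_eqF.
Qed.

Lemma normc_real (R : realType) (x : R) : normc x%:C%C = `|x|.
Proof. by rewrite /normc /= expr0n addr0 sqrtr_sqr. Qed.

Lemma normc_char_le1 (R : realType) (p : nat) (chi : {ffun 'F_p -> R[i]}) h :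
  dirichlet_character chi -> normc (chi h) <= 1.
Proof.
move=> chiD; rewrite -lecR -[X in X <= _]/(`|chi h|) dirichlet_character_norm//.
by case: (h != 0); rewrite ?lexx ?ler01.
Qed.

Lemma theta_partial_sum_le (R : realType) (Q N M p : nat) (chi : {ffun 'F_p -> R[i]}) h :
  (0 < p <= Q)%N -> (0 < N)%N -> (N < M)%N -> (h <= 1)%N ->
  Q%:R ^+ 2 <= expR (N%:R ^+ 2 / (2 * Q%:R)) :> R -> dirichlet_character chi ->
  normc (\sum_(1 <= n < M) chi n%:R * (theta_weight R p h n)%:C%C) <=
  20 * N%:R ^+ h * \sum_(m < N) normc (\sum_(n < m.+1) chi n.+1%:R) / m.+1%:R.
Proof.
move=> pQ N0 NM h1 QN chiD; have p0 : (0 < p)%N by case/andP: pQ.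
pose w n : R[i] := (theta_weight R p h n)%:C%C.
pose S m := \sum_(n < m) chi n.+1%:R.
have normw n : normc (w n) = theta_weight R p h n.
  by rewrite normc_real ger0_norm ?theta_weight_ge0.
have N0' : 0 < N%:R :> R by rewrite ltr0n.
have N1 : 1 <= N%:R :> R by rewrite (ler_nat R 1).
rewrite (big_cat_nat (n := N.+1))//= big_add1 /= big_mkord.
rewrite (abel_summation (fun n => chi n.+1%:R) w N).
have tail : normc (\sum_(N.+1 <= n < M) chi n%:R * w n) <= 8.
  apply: le_trans (normc_sum _ _ _) _.
  apply: (@le_trans _ _ (\sum_(N.+1 <= n < M) 8 * (n%:R ^+ 2)^-1)).
    apply: ler_sum_nat => n /andP[Nn _]; rewrite normcM normw.
    rewrite -[leRHS]mul1r; apply: ler_pM; rewrite ?normc_ge0 ?theta_weight_ge0//.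
      exact: normc_char_le1.
    by apply: theta_weight_tail QN => //; rewrite N0 ltnW.
  rewrite -big_distrr /=; have := sum_inv_sqr_le R N0 NM.
  have : 0 <= (M.-1)%:R^-1 :> R by rewrite invr_ge0.
  have : N%:R^-1 <= 1 :> R by rewrite invf_le1.
  lra.
have SN m : normc (S m) <= m%:R.
  apply: le_trans (normc_sum _ _ _) _.
  apply: (@le_trans _ _ (\sum_(n < m) 1)); last by rewrite sumr_const card_ord.
  by apply: ler_sum => n _; exact: normc_char_le1.
have bd : normc (S N * w N.+1) <= 8.
  rewrite normcM normw; apply: (@le_trans _ _ (N%:R * (8 / N.+1%:R ^+ 2))).
    apply: ler_pM; rewrite ?normc_ge0 ?theta_weight_ge0//.
    by apply: theta_weight_tail QN => //; rewrite N0 leqnSn.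
  rewrite mulrA ler_pdivrMr ?exprn_gt0 ?ltr0n// -[N.+1]addn1 natrD; nra.
pose T := \sum_(m < N) normc (S m.+1) / m.+1%:R.
(* The first term of [T] is the modulus of [chi 1], which is 1. So the tail and the boundary term,
   at most 8 each, are absorbed into the main term: 20 = 4 + 8 + 8. *)
have T1 : 1 <= N%:R ^+ h * T.
  apply: (@le_trans _ _ (1 * 1)); first by rewrite mulr1.
  apply: ler_pM => //; first by rewrite exprn_ege1.
  rewrite /T; case: (N) N0 => // N' _; rewrite big_ord_recl /S big_ord1 divr1.
  rewrite (proj1 chiD).1 normc1 lerDl sumr_ge0// => i _.
  by rewrite divr_ge0 ?normc_ge0.
have main : normc (\sum_(m < N) S m.+1 * (w m.+1 - w m.+2)) <= 4 * (N%:R ^+ h * T).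
  apply: le_trans (normc_sum _ _ _) _; rewrite /T !big_distrr /=.
  apply: ler_sum => m _; rewrite normcM -rmorphB normc_real.
  have wm := theta_weight_diff R p0 (ltn0Sn m) h1.
  apply: (@le_trans _ _ (normc (S m.+1) * (4 * m.+1%:R ^+ h / m.+1%:R))).
    by rewrite ler_wpM2l ?normc_ge0.
  have -> (x y : R) : x * (4 * y / m.+1%:R) = 4 * (y * (x / m.+1%:R)) by ring.
  rewrite ler_pM2l// ler_wpM2r ?divr_ge0 ?normc_ge0//.
  by rewrite lerXn2r ?nnegrE ?ler0n// ler_nat.
rewrite -/T -mulrA.
apply: le_trans (le_normcD _ _) _; apply: le_trans (lerD (le_normcD _ _) (lexx _)) _.
move: main bd tail; rewrite -/(S N); lra.
Qed.

Lemma theta_le (R : realType) (Q N p : nat) (chi : {ffun 'F_p -> R[i]}) :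
  (0 < p <= Q)%N -> (0 < N)%N ->
  Q%:R ^+ 2 <= expR (N%:R ^+ 2 / (2 * Q%:R)) :> R -> dirichlet_character chi ->
  normc (theta 1 chi) <=
  20 * N%:R ^+ Defs.eta chi *
    \sum_(m < N) normc (\sum_(n < m.+1) chi n.+1%:R) / m.+1%:R.
Proof.
move=> pQ N0 QN chiD; apply: normc_lim_le.
  rewrite mulr_ge0 ?mulr_ge0 ?exprn_ge0 ?sumr_ge0// => m _.
  by rewrite divr_ge0 ?normc_ge0.
exists N.+1 => // M /= NM.
by apply: (theta_partial_sum_le (h := Defs.eta chi)) QN chiD => //; rewrite /Defs.eta; case: ifP.
Qed.

(** Hölder's inequality for an integer exponent, by induction: each step trades a factor [m 1] for a
    factor [m 0] and a moment of order one higher. *)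
Lemma weighted_power_mean (R : realFieldType) (N n : nat) (w x : nat -> R) :
  (forall i, 0 <= w i) -> (forall i, 0 <= x i) ->
  (\sum_(i < N) w i * x i) ^+ n.+1 <=
  (\sum_(i < N) w i) ^+ n * \sum_(i < N) w i * x i ^+ n.+1.
Proof.
move=> w0 x0; pose m n := \sum_(i < N) w i * x i ^+ n.
have m_ge0 j : 0 <= m j by rewrite sumr_ge0// => i _; rewrite mulr_ge0 ?exprn_ge0.
have m0E : m 0%N = \sum_(i < N) w i by apply: eq_bigr => i _; rewrite mulr1.
have m1E : m 1%N = \sum_(i < N) w i * x i by apply: eq_bigr => i _; rewrite expr1.
(* Chebyshev's sum inequality *)
have cheb j : m 1%N * m j <= m 0%N * m j.+1.
  have : 0 <= \sum_(i < N) \sum_(k < N)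
      (w i * w k) * ((x i ^+ j - x k ^+ j) * (x i - x k)).
    rewrite sumr_ge0// => i _; rewrite sumr_ge0// => k _.
    apply: mulr_ge0; first exact: mulr_ge0.
    have [xik|xki] := leP (x i) (x k).
      by rewrite mulr_le0// subr_le0// lerXn2r ?nnegrE.
    by rewrite mulr_ge0 ?subr_ge0 ?lerXn2r ?nnegrE// ltW.
  have -> : \sum_(i < N) \sum_(k < N)
      (w i * w k) * ((x i ^+ j - x k ^+ j) * (x i - x k)) =
      (m 0%N * m j.+1 - m 1%N * m j) *+ 2.
    rewrite mulr2n.
    transitivity (\sum_(i < N) (w i * x i ^+ j.+1 * m 0%N - w i * x i ^+ j * m 1%N
        + (w i * m j.+1 - w i * x i * m j))).
      apply: eq_bigr => i _; rewrite /m !big_distrr /= -!sumrB -big_split /=.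
      by apply: eq_bigr => k _; rewrite !exprS expr0; ring.
    rewrite big_split /= !sumrB -!big_distrl /= -m0E -m1E -/(m j) -/(m j.+1); ring.
  by rewrite pmulrn_lge0// subr_ge0.
rewrite -m0E -m1E -/(m n.+1); elim: n => [|n IH]; first by rewrite expr0 mul1r expr1.
rewrite exprS; apply: le_trans (_ : m 1%N * (m 0%N ^+ n * m n.+1) <= _).
  by rewrite ler_wpM2l.
rewrite mulrCA exprSr -mulrA ler_wpM2l ?exprn_ge0//.
Qed.

(** [D] is the largest tau(n)^k for n <= N^k, so one value serves all lengths m <= N. *)
Lemma num_factorizations_bound (k j N : nat) : (0 < j)%N -> (0 < k)%N ->
  exists2 D : nat,
    forall m n, (m <= N)%N -> (0 < n <= m ^ k)%N -> (num_factorizations k m n <= D)%N &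
    (D ^ j <= (((j ^ j) ^ (2 ^ j)) * N ^ k) ^ k)%N.
Proof.
move=> j0 k0; exists ((\max_(n < (N ^ k).+1 | 0 < n) size (divisors n)) ^ k)%N.
  move=> m n mN /andP[n0 nm]; apply: leq_trans (num_factorizations_le k m n0) _.
  have nN : (n < (N ^ k).+1)%N by rewrite ltnS (leq_trans nm)// leq_exp2r.
  by rewrite leq_exp2r// (leq_bigmax_cond (Ordinal nN)).
rewrite -expnM mulnC expnM leq_exp2r//.
apply: (big_ind (fun x => x ^ j <= (j ^ j) ^ (2 ^ j) * N ^ k)%N).
- by rewrite exp0n.
- by move=> x y hx hy; rewrite /maxn; case: ifP.
move=> n n0; apply: leq_trans (size_divisors_exp_le j0 n0) _.
by rewrite leq_mul2l -ltnS ltn_ord orbT.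
Qed.

(** Hölder with the weights 1 / m moves the power inside the sum over [m], so that the sieve applies
    to each length separately; the price is a power of the harmonic sum. *)
Lemma theta_moment_le (R : realType) (Q N k D h : nat)
    (s : forall p, seq {ffun 'F_p -> R[i]}) :
  (0 < Q)%N -> (0 < N)%N -> (0 < k)%N ->
  Q%:R ^+ 2 <= expR (N%:R ^+ 2 / (2 * Q%:R)) :> R ->
  (forall p, prime p -> uniq (s p)) ->
  (forall p chi, prime p -> chi \in s p ->
    [/\ dirichlet_character chi, chi != principal_character R p & Defs.eta chi = h]) ->
  (forall m n, m <= N -> 0 < n <= m ^ k -> num_factorizations k m n <= D)%N ->
  \sum_(p < Q.+1 | prime p) \sum_(chi <- s p) normc (theta 1 chi) ^+ (2 * k) <=
  (20 * N%:R ^+ h * \sum_(m < N) m.+1%:R^-1) ^+ (2 * k) *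
  ((Q%:R ^+ 2 + 32 * N%:R ^+ k) * (D%:R * N%:R ^+ k)).
Proof.
move=> Q0 N0 k0 QN su sD dD.
set W := \sum_(m < N) m.+1%:R^-1; set B : R := (Q%:R ^+ 2 + 32 * N%:R ^+ k) * (D%:R * N%:R ^+ k).
pose c : R := 20 * N%:R ^+ h.
have c0 : 0 <= c by rewrite mulr_ge0 ?exprn_ge0.
have W0 : 0 <= W by rewrite sumr_ge0// => m _; rewrite invr_ge0.
pose S p (chi : {ffun 'F_p -> R[i]}) m := normc (\sum_(n < m.+1) chi n.+1%:R).
have [n kE] : exists n, (2 * k = n.+1)%N by exists (2 * k).-1; rewrite prednK// muln_gt0.
apply: (@le_trans _ _ (\sum_(p < Q.+1 | prime p) \sum_(chi <- s p)
    c ^+ n.+1 * W ^+ n * \sum_(m < N) m.+1%:R^-1 * S p chi m ^+ (2 * k))).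
  apply: ler_sum => p pp; rewrite big_seq [leRHS]big_seq; apply: ler_sum => chi chiS.
  have [chiD _ chih] := sD _ _ pp chiS.
  have pQ : (0 < p <= Q)%N by rewrite prime_gt0// -ltnS ltn_ord.
  have := theta_le pQ N0 QN chiD; rewrite chih -/c => th.
  apply: le_trans (_ : (c * \sum_(m < N) m.+1%:R^-1 * S p chi m) ^+ n.+1 <= _).
    rewrite kE lerXn2r ?nnegrE ?normc_ge0//.
      by rewrite mulr_ge0// sumr_ge0// => m _; rewrite mulr_ge0 ?invr_ge0 ?normc_ge0.
    by under eq_bigr do rewrite mulrC.
  rewrite exprMn -mulrA ler_wpM2l ?exprn_ge0// kE.
  apply: (weighted_power_mean N n (w := fun m => m.+1%:R^-1) (x := S p chi)).
    by move=> m; rewrite invr_ge0.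
  by move=> m; exact: normc_ge0.
under eq_bigr do rewrite -big_distrr exchange_big /=.
rewrite -big_distrr exchange_big /= kE -/c [(c * W) ^+ _]exprMn [W ^+ n.+1]exprSr -!mulrA.
rewrite ler_wpM2l ?exprn_ge0// ler_wpM2l ?exprn_ge0// /W big_distrl /=.
apply: ler_sum => m _.
under eq_bigr do rewrite -big_distrr /=; rewrite -big_distrr /=.
rewrite ler_wpM2l ?invr_ge0//.
have mN : (m.+1 <= N)%N by exact: ltn_ord.
rewrite -kE.
apply: le_trans (character_sum_moment (k := k) (m := m.+1) (D := D) Q0 (ltn0Sn _) su _ _) _.
- by move=> p chi pp /(sD _ _ pp)[].
- by move=> i ile i0; apply: (dD m.+1) => //; rewrite i0.
have mk : m.+1%:R ^+ k <= N%:R ^+ k :> R by rewrite lerXn2r ?nnegrE// ler_nat.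
rewrite /B; apply: ler_pM; rewrite ?addr_ge0 ?mulr_ge0 ?exprn_ge0//.
  by rewrite lerD2l ler_pM2l.
by rewrite ler_wpM2l.
Qed.

(** Each new term 1 / n is at most the increment of [ln], by ln(1 - 1/n) <= -1/n. *)
Lemma harmonic_le_ln (R : realType) (N : nat) : (0 < N)%N ->
  \sum_(m < N) m.+1%:R^-1 <= 1 + ln N%:R :> R.
Proof.
case: N => // N _; elim: N => [|N IH]; first by rewrite big_ord1 ln1 invr1 addr0.
rewrite big_ord_recr /=; apply: le_trans (lerD IH (lexx _)) _.
rewrite -addrA lerD2l addrC -lerBrDr.
have a0 : 0 < N.+1%:R :> R by rewrite ltr0n.
have b0 : 0 < N.+2%:R :> R by rewrite ltr0n.
rewrite -ln_div ?posrE//.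
have -> : N.+2%:R^-1 = - (- N.+2%:R^-1) :> R by rewrite opprK.
rewrite lerNl -lnV ?posrE ?divr_gt0// invf_div.
have -> : N.+1%:R / N.+2%:R = 1 + - N.+2%:R^-1 :> R.
  by rewrite -[N.+2]addn1 natrD; field; rewrite gt_eqF// addr_gt0.
by apply: le_ln1Dx; rewrite ltrN2 invf_lt1// ltr1n.
Qed.

(** ** Powers of X up to o(1) in the exponent *)

(** f(X) = O(X^a), with eventual nonnegativity built in so that such bounds can be multiplied. *)
Definition pow_bounded (R : realType) (f : R -> R) (a : R) :=
  exists C, \forall X \near +oo, 0 <= f X <= C * X `^ a.

Lemma near_pinfty_ge (R : realType) (a : R) : \forall X \near +oo, a <= X.
Proof. by apply: nbhs_pinfty_ge; rewrite num_real. Qed.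

Lemma pow_bounded_mul (R : realType) (f g : R -> R) a b :
  pow_bounded f a -> pow_bounded g b -> pow_bounded (fun X => f X * g X) (a + b).
Proof.
move=> [C fC] [D gD]; exists (C * D); near=> X.
have X1 : 1 <= X by near: X; exact: near_pinfty_ge.
have /andP[f0 fX] : 0 <= f X <= C * X `^ a by near: X.
have /andP[g0 gX] : 0 <= g X <= D * X `^ b by near: X.
rewrite mulr_ge0//= powRD; last by apply/implyP => _; rewrite gt_eqF// (lt_le_trans _ X1).
by rewrite mulrACA ler_pM.
Unshelve. all: by end_near. Qed.

Lemma pow_bounded_weaken (R : realType) (f : R -> R) a b :
  a <= b -> pow_bounded f a -> pow_bounded f b.
Proof.
move=> ab [C fC]; exists C; near=> X.
have X1 : 1 <= X by near: X; exact: near_pinfty_ge.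
have /andP[f0 fX] : 0 <= f X <= C * X `^ a by near: X.
have Xa : 0 < X `^ a by rewrite powR_gt0// (lt_le_trans _ X1).
have C0 : 0 <= C by rewrite -(pmulr_lge0 _ Xa) (le_trans f0).
by rewrite f0 (le_trans fX)// ler_wpM2l// ler_powR.
Unshelve. all: by end_near. Qed.

Lemma pow_bounded_add (R : realType) (f g : R -> R) a :
  pow_bounded f a -> pow_bounded g a -> pow_bounded (fun X => f X + g X) a.
Proof.
move=> [C fC] [D gD]; exists (C + D); near=> X.
have /andP[f0 fX] : 0 <= f X <= C * X `^ a by near: X.
have /andP[g0 gX] : 0 <= g X <= D * X `^ a by near: X.
by rewrite addr_ge0//= mulrDl lerD.
Unshelve. all: by end_near. Qed.

Lemma pow_bounded_cst (R : realType) (c : R) : 0 <= c -> pow_bounded (fun=> c) 0.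
Proof. by move=> c0; exists c; near=> X; rewrite c0 powRr0 mulr1 /=. Unshelve. all: by end_near. Qed.

Lemma pow_bounded_exprn (R : realType) (f : R -> R) a n :
  pow_bounded f a -> pow_bounded (fun X => f X ^+ n) (n%:R * a).
Proof.
move=> fa; elim: n => [|n IH].
  by rewrite mul0r; under eq_fun do rewrite expr0; exact: pow_bounded_cst.
rewrite -natr1 mulrDl mul1r addrC.
by under eq_fun do rewrite exprS; exact: pow_bounded_mul.
Qed.

Lemma pow_bounded_le (R : realType) (f g : R -> R) a :
  (\forall X \near +oo, 0 <= f X <= g X) -> pow_bounded g a -> pow_bounded f a.
Proof.
move=> fg [C gC]; exists C; near=> X.
have /andP[-> fX] : 0 <= f X <= g X by near: X.
have /andP[_ gX] : 0 <= g X <= C * X `^ a by near: X.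
exact: le_trans fX gX.
Unshelve. all: by end_near. Qed.

Lemma near_powR_ge (R : realType) (C a : R) : 0 < a ->
  \forall X \near +oo, C <= X `^ a.
Proof.
move=> a0; near=> X.
have X1 : Num.max 1 C `^ a^-1 <= X by near: X; exact: near_pinfty_ge.
have C1 : 0 <= Num.max 1 C by rewrite le_max ler01.
apply: (@le_trans _ _ (Num.max 1 C)); first by rewrite le_max lexx orbT.
rewrite -[leLHS](powRr1 C1) -(mulVf (lt0r_neq0 a0)) powRrM.
apply: ge0_ler_powR => //; rewrite ?nnegrE ?powR_ge0// ?ltW//.
Unshelve. all: by end_near. Qed.

(** [e X] is the excess of the true exponent [ln (F X) / ln X] over [A], cut off at 0: the
    inequality then holds by construction, and the bound with loss d / 2 gives e X <= d eventually,
    X^(d/2) absorbing the constant. *)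
Lemma pow_bounded_exponent (R : realType) (F : R -> R) (A : R) : 0 <= A ->
  (forall d, 0 < d -> pow_bounded F (A + d)) ->
  exists2 e : R -> R, e X @[X --> +oo] --> 0 &
    \forall X \near +oo, F X <= X `^ (A + e X).
Proof.
move=> A0 FA; exists (fun X => Num.max 0 (ln (F X) / ln X - A)).
  apply/cvgrPdist_le => d d0.
  have d2 : 0 < d / 2 by rewrite divr_gt0.
  have [C FC] := FA _ d2; near=> X.
  have X2 : 2 <= X by near: X; exact: near_pinfty_ge.
  have X1 : 1 < X by rewrite (lt_le_trans _ X2)// ltr1n.
  have X0 : 0 < X by rewrite (lt_trans _ X1).
  have lX : 0 < ln X by rewrite ln_gt0.
  have /andP[F0 FX] : 0 <= F X <= C * X `^ (A + d / 2) by near: X.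
  have CX : C <= X `^ (d / 2) by near: X; exact: near_powR_ge.
  rewrite sub0r normrN ger0_norm ?le_max ?lexx// ge_max ltW//=.
  rewrite lerBlDr ler_pdivrMr//.
  have FXd : F X <= X `^ (A + d).
    apply: le_trans FX _; rewrite [in leRHS](splitr d) addrA [leRHS]powRD.
      by rewrite [leRHS]mulrC ler_wpM2r// powR_ge0.
    by apply/implyP => _; rewrite gt_eqF.
  (* [ln] is 0 at nonpositive arguments, so this case rests on 0 <= A. *)
  have [F1|F1] := leP (F X) 0.
    by rewrite ln0// mulr_ge0 ?addr_ge0// ltW.
  by rewrite addrC -ln_powR ler_ln ?posrE// powR_gt0.
have [C FC] := FA 1 ltr01; near=> X.
have X2 : 2 <= X by near: X; exact: near_pinfty_ge.
have X1 : 1 < X by rewrite (lt_le_trans _ X2)// ltr1n.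
have X0 : 0 < X by rewrite (lt_trans _ X1).
have lX : 0 < ln X by rewrite ln_gt0.
have [F1|F1] := leP (F X) 0; first by rewrite (le_trans F1) ?powR_ge0.
rewrite -[leLHS]lnK ?posrE// -[leRHS]lnK ?posrE ?powR_gt0// ler_expR ln_powR.
by rewrite -ler_pdivrMr// addrC -lerBlDr le_max lexx orbT.
Unshelve. all: by end_near. Qed.

Lemma ln_le_powR (R : realType) (x d : R) : 0 < x -> 0 < d -> ln x <= x `^ d / d.
Proof.
move=> x0 d0; rewrite ler_pdivlMr// mulrC -ln_powR.
have : ln (1 + (x `^ d - 1)) <= x `^ d - 1.
  by apply: le_ln1Dx; rewrite ltrBrDr addNr powR_gt0.
by rewrite addrC subrK; lra.
Qed.

(** The divisor bound controls only [D ^ j]; dividing its exponent by a large [j] makes that of [D]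
    as small as desired. *)
Lemma pow_bounded_root (R : realType) (f : R -> R) a (j : nat) : (0 < j)%N ->
  (forall X, 0 <= f X) -> pow_bounded (fun X => f X ^+ j) a ->
  pow_bounded f (a / j%:R).
Proof.
move=> j0 f0 [C fC]; exists (C `^ j%:R^-1); near=> X.
have X1 : 1 <= X by near: X; exact: near_pinfty_ge.
have X0 : 0 <= X by exact: le_trans X1.
have /andP[g0 gX] : 0 <= f X ^+ j <= C * X `^ a by near: X.
have C0 : 0 <= C.
  have Xa : 0 < X `^ a by rewrite powR_gt0// (lt_le_trans _ X1).
  by rewrite -(pmulr_lge0 _ Xa) (le_trans g0).
rewrite f0 /= powRrM -powRM ?powR_ge0//.
rewrite [leLHS](_ : _ = (f X ^+ j) `^ j%:R^-1); last first.
  by rewrite -powR_mulrn// -powRrM mulfV ?powRr1// pnatr_eq0 -lt0n.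
by apply: ge0_ler_powR; rewrite ?invr_ge0 ?nnegrE// mulr_ge0 ?powR_ge0.
Unshelve. all: by end_near. Qed.

Lemma pow_bounded_truncn (R : realType) : pow_bounded (fun X : R => (Num.truncn X)%:R) 1.
Proof.
exists 1; near=> X; have X1 : 1 <= X by near: X; exact: near_pinfty_ge.
have X0 : 0 <= X by exact: le_trans X1.
by rewrite mul1r powRr1// truncn_le X0 ler0n.
Unshelve. all: by end_near. Qed.

(** The length [N] of the overview. The successor makes it positive and larger than X^(1/2 + d). *)
Definition cutoff (R : realType) (d X : R) : nat := (Num.truncn (X `^ (1 / 2 + d))).+1.

Lemma pow_bounded_cutoff (R : realType) (d : R) : 0 < d ->
  pow_bounded (fun X => (cutoff d X)%:R) (1 / 2 + d).
Proof.
move=> d0; exists 2; near=> X.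
have X1 : 1 <= X by near: X; exact: near_pinfty_ge.
have P1 : 1 <= X `^ (1 / 2 + d) by rewrite -[leLHS](powRr0 X) ler_powR//; lra.
have : (Num.truncn (X `^ (1 / 2 + d)))%:R <= X `^ (1 / 2 + d).
  by rewrite truncn_le powR_ge0.
by rewrite /cutoff ler0n -natr1 /=; lra.
Unshelve. all: by end_near. Qed.

(** From ln X <= X^d / d and 4 / d <= X^d one gets 2 ln X <= X^(2d) / 2, while N^2 >= X^(1 + 2d) and
    the truncation of [X] is at most [X]. *)
Lemma cutoff_large (R : realType) (d : R) : 0 < d -> \forall X \near +oo,
  (Num.truncn X)%:R ^+ 2 <=
  expR ((cutoff d X)%:R ^+ 2 / (2 * (Num.truncn X)%:R)) :> R.
Proof.
move=> d0; near=> X; have X1 : 1 <= X by near: X; exact: near_pinfty_ge.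
have X0 : 0 < X by exact: lt_le_trans X1.
have Xd : 4 / d <= X `^ d by near: X; exact: near_powR_ge.
have Q0 : 0 < (Num.truncn X)%:R :> R by rewrite ltr0n truncn_gt0.
have QX : (Num.truncn X)%:R <= X by rewrite truncn_le ltW.
apply: (@le_trans _ _ (X ^+ 2)); first by rewrite lerXn2r ?nnegrE// ltW.
rewrite -[X in X ^+ 2]lnK ?posrE// -expRM_natl ler_expR.
apply: (@le_trans _ _ (X `^ d * X `^ d / 2)).
  have lnX := ln_le_powR X0 d0.
  have : X `^ d * (4 / d) <= X `^ d * X `^ d by rewrite ler_wpM2l ?powR_ge0.
  by lra.
have XdN : X * (X `^ d * X `^ d) <= (cutoff d X)%:R ^+ 2.
  have -> : X * (X `^ d * X `^ d) = (X `^ (1 / 2 + d)) ^+ 2.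
    have nz r : (r == 0) ==> (X != 0) by apply/implyP => _; rewrite gt_eqF.
    rewrite -{1}(powRr1 (ltW X0)) -!powRD ?nz// -powR_mulrn ?powR_ge0// -powRrM.
    by congr (_ `^ _); field.
  rewrite lerXn2r ?nnegrE ?powR_ge0// ltW//.
  by have /andP[] := truncn_itv (powR_ge0 X (1 / 2 + d)).
rewrite ler_pdivlMr ?mulr_gt0//; apply: le_trans XdN.
have -> (x y : R) : x / 2 * (2 * y) = y * x by field.
by rewrite ler_wpM2r// mulr_ge0 ?powR_ge0.
Unshelve. all: by end_near. Qed.

Lemma cutoff_le (R : realType) (d : R) : 0 < d <= 1 / 2 -> \forall X \near +oo,
  (cutoff d X)%:R <= 2 * X.
Proof.
move=> /andP[d0 d1]; near=> X.
have X1 : 1 <= X by near: X; exact: near_pinfty_ge.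
have X0 : 0 <= X by exact: le_trans X1.
have : (Num.truncn (X `^ (1 / 2 + d)))%:R <= X `^ (1 / 2 + d).
  by rewrite truncn_le powR_ge0.
have : X `^ (1 / 2 + d) <= X `^ 1 by rewrite ler_powR//; lra.
by rewrite powRr1// /cutoff -natr1; lra.
Unshelve. all: by end_near. Qed.

Lemma pow_bounded_harmonic (R : realType) (d : R) : 0 < d <= 1 / 2 ->
  pow_bounded (fun X => \sum_(m < cutoff d X) m.+1%:R^-1 : R) d.
Proof.
move=> dd; have /andP[d0 d1] := dd; exists (1 + 2 `^ d / d); near=> X.
have X1 : 1 <= X by near: X; exact: near_pinfty_ge.
have X0 : 0 <= X by exact: le_trans X1.
have NX : (cutoff d X)%:R <= 2 * X by near: X; exact: cutoff_le.
rewrite sumr_ge0/=; first last; first by move=> m _; rewrite invr_ge0.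
apply: le_trans (harmonic_le_ln _ _) _; first exact: ltn0Sn.
rewrite mulrDl mul1r; apply: lerD.
  by rewrite -[leLHS](powRr0 X) ler_powR// ltW.
apply: le_trans (ln_le_powR _ d0) _; first by rewrite ltr0n.
rewrite mulrAC ler_pM2r ?invr_gt0// -powRM//.
by apply: ge0_ler_powR; rewrite ?nnegrE ?mulr_ge0// ltW.
Unshelve. all: by end_near. Qed.

(** * Choice of the parameters and conclusion *)

Lemma theta_moment_pow_bounded (R : realType) (k h : nat)
    (s : forall p, seq {ffun 'F_p -> R[i]}) : (2 <= k <= 6)%N ->
  (forall p, prime p -> uniq (s p)) ->
  (forall p chi, prime p -> chi \in s p ->
    [/\ dirichlet_character chi, chi != principal_character R p & Defs.eta chi = h]) ->
  (h <= 1)%N ->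
  forall e, 0 < e ->
  pow_bounded (fun X : R => \sum_(p < (Num.truncn X).+1 | prime p)
      \sum_(chi <- s p) normc (theta 1 chi) ^+ (2 * k))
    (3 * k%:R / 4 + 3 / 2 + h%:R * k%:R + e).
Proof.
move=> /andP[k2 k6] su sD h1 e e0.
have k2' : 2 <= k%:R :> R by rewrite (ler_nat R 2).
have k6' : k%:R <= 6 :> R by rewrite (ler_nat R _ 6).
have h1' : h%:R <= 1 :> R by rewrite (ler_nat R _ 1).
have h0' : 0 <= h%:R :> R by [].
have k0 : (0 < k)%N by apply: leq_trans k2.
(* The total loss is at most 37 d: 13 d in [E] below, and 2 h k d + 2 k d <= 24 d from the outer
   factor. The cap 1/2 is for the harmonic sum. *)
pose d : R := Num.min (1 / 2) (e / 40).
have d0 : 0 < d by rewrite lt_min !divr_gt0.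
have d1 : d <= 1 / 2 by rewrite ge_min lexx.
have de : d <= e / 40 by rewrite ge_min lexx orbT.
have dd : 0 < d <= 1 / 2 by rewrite d0.
clearbody d.
(* The bound for [D ^ j] has exponent k^2 (1/2 + d) <= 36, so this [j] leaves at most [d] for
   [D]. *)
pose j := (Num.truncn (36 / d)).+1.
have jd : 36 / d <= j%:R.
  by have /andP[_ /ltW] := truncn_itv (divr_ge0 (ler0n R 36) (ltW d0)).
pose N := @cutoff R d.
(* The cutoff moves with [X], so the bound is chosen as a function of the length. *)
have /choice[D DP] : forall M : nat, exists D : nat,
    (forall m n, (m <= M)%N -> (0 < n <= m ^ k)%N -> (num_factorizations k m n <= D)%N) /\
    (D ^ j <= (((j ^ j) ^ (2 ^ j)) * M ^ k) ^ k)%N.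
  by move=> M; have [D] := num_factorizations_bound M (ltn0Sn _ : 0 < j)%N k0; exists D.
have NB : pow_bounded (fun X => (N X)%:R) (1 / 2 + d) := pow_bounded_cutoff d0.
have NkB := pow_bounded_exprn k NB.
have DB : pow_bounded (fun X => (D (N X))%:R) d.
  have KB : pow_bounded (fun X => (((j ^ j) ^ (2 ^ j))%:R * (N X)%:R ^+ k) ^+ k)
      (k%:R * (0 + k%:R * (1 / 2 + d))).
    by apply: pow_bounded_exprn; apply: pow_bounded_mul NkB; exact: pow_bounded_cst.
  apply: pow_bounded_weaken (pow_bounded_root (ltn0Sn _ : 0 < j)%N _ (pow_bounded_le _ KB)).
  - have j0 : 0 < j%:R :> R by rewrite ltr0n.
    rewrite ler_pdivrMr// add0r; apply: (@le_trans _ _ (d * (36 / d))).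
      have -> : d * (36 / d) = 36 by field; rewrite gt_eqF.
      have kd : k%:R * (1 / 2 + d) <= 6 by nra.
      by nra.
    by rewrite ler_pM2l.
  - by [].
  near=> X; rewrite exprn_ge0//= -!natrX -natrM -natrX ler_nat.
  exact: (DP _).2.
pose G X : R := (20 * (N X)%:R ^+ h * \sum_(m < N X) m.+1%:R^-1) ^+ (2 * k) *
  ((Num.truncn X)%:R ^+ 2 * ((D (N X))%:R * (N X)%:R ^+ k) +
    32 * (N X)%:R ^+ k * ((D (N X))%:R * (N X)%:R ^+ k)).
apply: (@pow_bounded_le _ _ G).
  near=> X; have X1 : 1 <= X by near: X; exact: near_pinfty_ge.
  have NQ : (Num.truncn X)%:R ^+ 2 <= expR ((N X)%:R ^+ 2 / (2 * (Num.truncn X)%:R)) :> R.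
    by near: X; exact: cutoff_large.
  rewrite sumr_ge0 => [|p _]; last by rewrite sumr_ge0// => chi _; rewrite exprn_ge0// normc_ge0.
  rewrite /G -mulrDl /=.
  apply: theta_moment_le NQ su sD (DP _).1 => //.
  by rewrite truncn_gt0.
have AB := pow_bounded_exprn (2 * k) (pow_bounded_mul
  (pow_bounded_mul (pow_bounded_cst (ler0n R 20)) (pow_bounded_exprn h NB))
  (pow_bounded_harmonic dd)).
have MB := pow_bounded_mul DB NkB.
(* 13 = 1 + 2 * 6: one [d] for the divisor bound and k d <= 6 d for each of at most two factors
   N^k. *)
pose E : R := 3 * k%:R / 4 + 3 / 2 + 13 * d.
have kd : k%:R * d <= 6 * d by rewrite ler_wpM2r// ltW.
have hkd : h%:R * (k%:R * d) <= 6 * d.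
  by apply: le_trans kd; rewrite ler_piMl// mulr_ge0// ltW.
have BB : pow_bounded (fun X => (Num.truncn X)%:R ^+ 2 * ((D (N X))%:R * (N X)%:R ^+ k) +
    32 * (N X)%:R ^+ k * ((D (N X))%:R * (N X)%:R ^+ k)) E.
  apply: pow_bounded_add.
    apply: pow_bounded_weaken (pow_bounded_mul (pow_bounded_exprn 2 (pow_bounded_truncn R)) MB).
    by rewrite /E; lra.
  apply: pow_bounded_weaken (pow_bounded_mul
    (pow_bounded_mul (pow_bounded_cst (ler0n R 32)) NkB) MB).
  by rewrite /E; lra.
apply: pow_bounded_weaken (pow_bounded_mul AB BB).
by rewrite natrM /E; lra.
Unshelve. all: by end_near. Qed.

(* finite_support is empty when the support is infinite, so the finiteness of the
   set of characters plays no role. *)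
Lemma moment_exponent (R : realType) (k h : nat) (A : forall p, set {ffun 'F_p -> R[i]}) :
  (2 <= k <= 6)%N -> (h <= 1)%N ->
  (forall p chi, prime p -> A p chi ->
    [/\ dirichlet_character chi, chi != principal_character R p & Defs.eta chi = h]) ->
  exists2 e : R -> R, e X @[X --> +oo] --> 0 &
    \forall X \near +oo,
      \sum_(p < (Num.truncn X).+1 | prime p)
         \sum_(chi \in A p) normc (theta 1 chi) ^+ (2 * k)
        <= X `^ (3 * k%:R / 4 + 3 / 2 + h%:R * k%:R + e X).
Proof.
move=> k26 h1 AP; apply: pow_bounded_exponent => [|d d0].
  by rewrite !addr_ge0 ?divr_ge0 ?mulr_ge0.
apply: (theta_moment_pow_bounded (s := fun p => finite_support 0 (A p)
  (fun chi => normc (theta 1 chi) ^+ (2 * k)))) => // [p _|p chi pp]; first exact: finite_support_uniq.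
case: finite_supportP => // S SA _ _ /SA; exact: AP.
Qed.

Theorem theorem1p4 (R : realType) (k : nat) (hk : (3 <= k <= 6)%N) :
  (exists2 e : R -> R, e X @[X --> +oo] --> 0 &
    \forall X \near +oo,
      \sum_(p < (Num.truncn X).+1 | prime p) T_plus R k p
        <= X `^ (3 * k%:R / 4 + 3 / 2 + e X)) /\
  (exists2 e : R -> R, e X @[X --> +oo] --> 0 &
    \forall X \near +oo,
      \sum_(p < (Num.truncn X).+1 | prime p) S_minus R k p
        <= X `^ (7 * k%:R / 4 + 3 / 2 + e X)).
Proof.
have k26 : (2 <= k <= 6)%N by case/andP: hk => k3 ->; rewrite ltnW.
have N11 : (1 == -1 :> R[i]) = false.
  by rewrite -subr_eq0 opprK (pnatr_eq0 _ 2).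
split.
  have := @moment_exponent R k 0
    (fun p => even_characters R p `\ principal_character R p) k26 isT.
  rewrite mul0r addr0; apply=> p chi _ [[chiD chiN1] /eqP chi0]; split => //.
  by rewrite /Defs.eta chiN1 N11.
have -> : 7 * k%:R / 4 + 3 / 2 = 3 * k%:R / 4 + 3 / 2 + 1%:R * k%:R :> R by field.
apply: (@moment_exponent R k 1 (fun p => odd_characters R p) k26 isT).
move=> p chi _ [chiD chiN1]; split => //; last by rewrite /Defs.eta chiN1 eqxx.
(* The principal character takes the value 1 at -1, so it is not odd. *)
apply/eqP => chiE; move: chiN1; rewrite chiE ffunE unitrN unitr1 => /eqP.
by rewrite N11.
Qed.
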